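(* Let $\vec N = N_1,\ldots,N_n$ be LF objects, $\vec x = x_1,\ldots,x_n$ distinct object variables, and $\vec B = B_1,\ldots,B_n$ canonical LF types. Let $\Gamma$ and $\Delta$ be LF contexts and let $\delta=\mathrm{dom}(\Delta)$. Let $\Gamma_0 = x_1:B_1,\ldots,x_n:B_n$. Let $\Pi x_1{:}B_1.\cdots\Pi x_n{:}B_n.\,A$ be a canonical type, where $A$ is a base type. Suppose that, for some index $i$, the following are derivable: (1) $\vec x; x_i \Vdash_{\mathrm{t}} A$ ($x_i$ occurs rigidly in the type $A$); (2) $\Gamma,\Gamma_0,\Delta \vdash A : \mathrm{type}$; (3) $\Gamma,\Delta[N_1/x_1,\ldots,N_n/x_n] \vdash A[N_1/x_1,\ldots,N_n/x_n] : \mathrm{type}$. Then $\Gamma \vdash N_i : B_i[N_1/x_1,\ldots,N_{i-1}/x_{i-1}]$ is derivable.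
   Context: LF (the Edinburgh Logical Framework) is the dependently typed $\lambda$-calculus with kinds $K ::= \mathrm{type} \mid \Pi x{:}A.K$, types $A ::= u \mid \Pi x{:}A.B \mid \lambda x{:}A.B \mid A\,M$ and objects $M ::= x \mid \lambda x{:}A.M \mid M\,N$, with the standard typing judgments $\vdash \Gamma\ \mathrm{ctx}$, $\Gamma\vdash K\ \mathrm{kind}$, $\Gamma\vdash A:K$, $\Gamma\vdash M:A$. All judgments are taken in canonical LF: all expressions are in $\beta\eta$-long form, and the application and variable rules are replaced by the backchaining rule: if $(y:\Pi x_1{:}B_1\ldots\Pi x_n{:}B_n.A)\in\Gamma$ and $\Gamma\vdash N_j : B_j[N_1/x_1,\ldots,N_{j-1}/x_{j-1}]$ for each $j$, then $\Gamma\vdash y\,N_1\cdots N_n : A[N_1/x_1,\ldots,N_n/x_n]$ (similarly for type families). A base type is a type of $\beta\eta$-long form $u\,M_1\cdots M_n$. $P[N_1/x_1,\ldots]$ denotes capture-avoiding simultaneous substitution; substitution into a context applies to each type in it. Rigidity for objects, $\Gamma;\delta;x\Vdash M$ ($\Gamma,\delta$ lists of variables), is defined inductively by: $\Gamma;\delta;x\Vdash x\,y_1\cdots y_k$ whenever $y_1,\ldots,y_k$ are distinct elements of $\delta$; $\Gamma;\delta;x \Vdash y\,M_1\cdots M_m$ if $y\notin\Gamma$ and $\Gamma;\delta;x\Vdash M_j$ for some $j$; $\Gamma;\delta;x\Vdash \lambda y{:}A.M$ if $\Gamma;\delta,y;x\Vdash M$. Rigidity for types, $\Gamma;x\Vdash_{\mathrm{t}}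 A$, is defined by: $\Gamma;x\Vdash_{\mathrm{t}} c\,M_1\cdots M_m$ if $\Gamma;\cdot;x\Vdash M_j$ for some $j$ (with $\cdot$ the empty list); $\Gamma;x\Vdash_{\mathrm{t}}\Pi y{:}A.B$ if $\Gamma,y;x\Vdash_{\mathrm{t}} B$. In the claim the list $\Gamma$ in this judgment is $\vec x$.
   Formalization: The N_j are in the scope of Γ (not Δ), and (3) and the conclusion are read up to βη-conversion: some N' βη-convertible to N_i has a type βη-convertible to B_i[N_1/x_1,…]; verbatim the claim fails for N_1 = λz:p.z, A = c(λy:o. x_1 y) with x_1 : o→o. *)

(* Defs.v *)
From Stdlib Require Import Relations.
From mathcomp Require Import all_boot.

Set Implicit Arguments.
Unset Strict Implicit.
Unset Printing Implicit Defensive.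

(* Object variables are de Bruijn indices.  Type-family variables are bound   *)
(* only by contexts and never substituted for, so they are plain names.       *)
Definition fname := nat.

Inductive obj : Type :=
| Var of nat
| Lam of fam & obj
| App of obj & obj
with fam : Type :=
| FVar of fname
| Pi of fam & fam
| FLam of fam & fam
| FApp of fam & obj.

Inductive kind : Type :=
| KType
| KPi of fam & kind.

Definition up_ren (r : nat -> nat) (k : nat) : nat :=
  if k is k'.+1 then (r k').+1 else 0.

Fixpoint obj_ren (r : nat -> nat) (M : obj) : obj :=
  match M with
  | Var k => Var (r k)
  | Lam A M => Lam (fam_ren r A) (obj_ren (up_ren r) M)
  | App M N => App (obj_ren r M) (obj_ren r N)
  end
with fam_ren (r : nat -> nat) (A : fam) : fam :=
  match A with
  | FVar u => FVar u
  | Pi A B => Pi (fam_ren r A) (fam_ren (up_ren r) B)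
  | FLam A B => FLam (fam_ren r A) (fam_ren (up_ren r) B)
  | FApp A M => FApp (fam_ren r A) (obj_ren r M)
  end.

Fixpoint kind_ren (r : nat -> nat) (K : kind) : kind :=
  match K with
  | KType => KType
  | KPi A K => KPi (fam_ren r A) (kind_ren (up_ren r) K)
  end.

Definition up (s : nat -> obj) (k : nat) : obj :=
  if k is k'.+1 then obj_ren succn (s k') else Var 0.

Fixpoint obj_subst (s : nat -> obj) (M : obj) : obj :=
  match M with
  | Var k => s k
  | Lam A M => Lam (fam_subst s A) (obj_subst (up s) M)
  | App M N => App (obj_subst s M) (obj_subst s N)
  end
with fam_subst (s : nat -> obj) (A : fam) : fam :=
  match A with
  | FVar u => FVar u
  | Pi A B => Pi (fam_subst s A) (fam_subst (up s) B)
  | FLam A B => FLam (fam_subst s A) (fam_subst (up s) B)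
  | FApp A M => FApp (fam_subst s A) (obj_subst s M)
  end.

Fixpoint kind_subst (s : nat -> obj) (K : kind) : kind :=
  match K with
  | KType => KType
  | KPi A K => KPi (fam_subst s A) (kind_subst (up s) K)
  end.

(* [inst [:: N_1; ..; N_n]] is the simultaneous substitution                  *)
(* [N_1/x_1, .., N_n/x_n] for expressions in scope G, x_1, .., x_n; the N_j   *)
(* are in scope G, and x_n, the variable bound last, has index 0.             *)
Definition inst (Ns : seq obj) (k : nat) : obj :=
  nth (Var (k - size Ns)) (rev Ns) k.

Definition apps (M : obj) (Ns : seq obj) : obj := foldl App M Ns.
Definition fapps (A : fam) (Ns : seq obj) : fam := foldl FApp A Ns.
Definition pis (Bs : seq fam) (A : fam) : fam := foldr Pi A Bs.
Definition kpis (Bs : seq fam) (K : kind) : kind := foldr KPi K Bs.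

Definition is_base (A : fam) : Prop :=
  exists u Ms, A = fapps (FVar u) Ms.

(* One-step reduction: beta alone when [eta = false], beta-eta otherwise.     *)
Inductive obj_red (eta : bool) : obj -> obj -> Prop :=
| obj_beta A M N :
    obj_red eta (App (Lam A M) N) (obj_subst (inst [:: N]) M)
| obj_eta A M :
    eta -> obj_red eta (Lam A (App (obj_ren succn M) (Var 0))) M
| obj_red_lam1 A A' M :
    fam_red eta A A' -> obj_red eta (Lam A M) (Lam A' M)
| obj_red_lam2 A M M' :
    obj_red eta M M' -> obj_red eta (Lam A M) (Lam A M')
| obj_red_app1 M M' N :
    obj_red eta M M' -> obj_red eta (App M N) (App M' N)
| obj_red_app2 M N N' :
    obj_red eta N N' -> obj_red eta (App M N) (App M N')
with fam_red (eta : bool) : fam -> fam -> Prop :=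
| fam_beta A B N :
    fam_red eta (FApp (FLam A B) N) (fam_subst (inst [:: N]) B)
| fam_eta A B :
    eta -> fam_red eta (FLam A (FApp (fam_ren succn B) (Var 0))) B
| fam_red_pi1 A A' B :
    fam_red eta A A' -> fam_red eta (Pi A B) (Pi A' B)
| fam_red_pi2 A B B' :
    fam_red eta B B' -> fam_red eta (Pi A B) (Pi A B')
| fam_red_lam1 A A' B :
    fam_red eta A A' -> fam_red eta (FLam A B) (FLam A' B)
| fam_red_lam2 A B B' :
    fam_red eta B B' -> fam_red eta (FLam A B) (FLam A B')
| fam_red_app1 A A' N :
    fam_red eta A A' -> fam_red eta (FApp A N) (FApp A' N)
| fam_red_app2 A N N' :
    obj_red eta N N' -> fam_red eta (FApp A N) (FApp A N').

Definition beta_nf (A A' : fam) : Prop :=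
  clos_refl_trans fam (fam_red false) A A' /\
  forall A'', ~ fam_red false A' A''.

Definition obj_conv : relation obj := clos_refl_sym_trans obj (obj_red true).
Definition fam_conv : relation fam := clos_refl_sym_trans fam (fam_red true).

Inductive kind_conv : kind -> kind -> Prop :=
| kind_conv_type : kind_conv KType KType
| kind_conv_pi A A' K K' :
    fam_conv A A' -> kind_conv K K' -> kind_conv (KPi A K) (KPi A' K').

(* There is no separate signature: a context declares both object variables   *)
(* and type-family variables.  The most recent declaration comes first.       *)
Inductive decl : Type :=
| DObj of fam
| DFam of fname & kind.

Definition ctx := seq decl.

Definition nobj (G : ctx) : nat :=
  count (fun D => if D is DObj _ then true else false) G.

Definition fam_dom (G : ctx) : seq fname :=
  pmap (fun D => if D is DFam u _ then Some u else None) G.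

Definition decl_subst (s : nat -> obj) (D : decl) : decl :=
  match D with
  | DObj A => DObj (fam_subst s A)
  | DFam u K => DFam u (kind_subst s K)
  end.

Fixpoint ctx_subst (s : nat -> obj) (D : ctx) : ctx :=
  if D is d :: D' then decl_subst (iter (nobj D') up s) d :: ctx_subst s D'
  else [::].

Inductive decl_conv : decl -> decl -> Prop :=
| decl_conv_obj A A' : fam_conv A A' -> decl_conv (DObj A) (DObj A')
| decl_conv_fam u K K' : kind_conv K K' -> decl_conv (DFam u K) (DFam u K').

Inductive ctx_conv : ctx -> ctx -> Prop :=
| ctx_conv_nil : ctx_conv [::] [::]
| ctx_conv_cons d d' G G' :
    decl_conv d d' -> ctx_conv G G' -> ctx_conv (d :: G) (d' :: G').

Inductive obj_in : ctx -> nat -> fam -> Prop :=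
| obj_in_here G A : obj_in (DObj A :: G) 0 (fam_ren succn A)
| obj_in_obj G k A B :
    obj_in G k A -> obj_in (DObj B :: G) k.+1 (fam_ren succn A)
| obj_in_fam G k A u K : obj_in G k A -> obj_in (DFam u K :: G) k A.

Inductive fam_in : ctx -> fname -> kind -> Prop :=
| fam_in_here G u K : fam_in (DFam u K :: G) u K
| fam_in_obj G u K B :
    fam_in G u K -> fam_in (DObj B :: G) u (kind_ren succn K)
| fam_in_fam G u K v L : fam_in G u K -> fam_in (DFam v L :: G) u K.

(* Canonical LF.  The target of a backchaining step is a base type (or the    *)
(* kind "type"), so every derivable expression is beta-normal and eta-long.   *)
(* Instantiating eta-long expressions by eta-long objects only creates beta-  *)
(* redexes, so the long form of B_j[N_1/x_1, ..] is its beta-normal form.     *)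
Inductive ctx_wf : ctx -> Prop :=
| ctx_wf_nil : ctx_wf [::]
| ctx_wf_obj G A :
    ctx_wf G -> has_kind G A KType -> ctx_wf (DObj A :: G)
| ctx_wf_fam G u K :
    ctx_wf G -> u \notin fam_dom G -> kind_wf G K -> ctx_wf (DFam u K :: G)
with kind_wf : ctx -> kind -> Prop :=
| kind_wf_type G : ctx_wf G -> kind_wf G KType
| kind_wf_pi G A K :
    has_kind G A KType -> kind_wf (DObj A :: G) K -> kind_wf G (KPi A K)
with has_kind : ctx -> fam -> kind -> Prop :=
| has_kind_pi G A B :
    has_kind G A KType -> has_kind (DObj A :: G) B KType ->
    has_kind G (Pi A B) KType
| has_kind_lam G A B K :
    has_kind G A KType -> has_kind (DObj A :: G) B K ->
    has_kind G (FLam A B) (KPi A K)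
| has_kind_backchain G u (Bs Cs : seq fam) (Ns : seq obj) :
    ctx_wf G -> fam_in G u (kpis Bs KType) ->
    size Ns = size Bs ->
    (forall j, j < size Bs ->
       beta_nf (fam_subst (inst (take j Ns)) (nth (FVar 0) Bs j))
               (nth (FVar 0) Cs j)) ->
    (forall j, j < size Bs ->
       has_type G (nth (Var 0) Ns j) (nth (FVar 0) Cs j)) ->
    has_kind G (fapps (FVar u) Ns) KType
with has_type : ctx -> obj -> fam -> Prop :=
| has_type_lam G A M B :
    has_kind G A KType -> has_type (DObj A :: G) M B ->
    has_type G (Lam A M) (Pi A B)
| has_type_backchain G y (Bs Cs : seq fam) A A' (Ns : seq obj) :
    ctx_wf G -> obj_in G y (pis Bs A) -> is_base A ->
    size Ns = size Bs ->
    (forall j, j < size Bs ->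
       beta_nf (fam_subst (inst (take j Ns)) (nth (FVar 0) Bs j))
               (nth (FVar 0) Cs j)) ->
    (forall j, j < size Bs ->
       has_type G (nth (Var 0) Ns j) (nth (FVar 0) Cs j)) ->
    beta_nf (fam_subst (inst Ns) A) A' ->
    has_type G (apps (Var y) Ns) A'.

(* For arbitrary M and A, with G canonical: the judgment holds of the         *)
(* beta-eta-long forms of M and A.                                            *)
Definition lf_has_type (G : ctx) (M : obj) (A : fam) : Prop :=
  exists M' A', [/\ obj_conv M M', fam_conv A A' & has_type G M' A'].

(* For arbitrary D and A, with G canonical: "G, D |- A : type" holds of the   *)
(* beta-eta-long forms of D and A.                                            *)
Definition lf_is_type (G D : ctx) (A : fam) : Prop :=
  exists D' A', [/\ ctx_conv D D', fam_conv A A' & has_kind (D' ++ G) A' KType].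

(* In a beta-eta-long expression the arguments y_1, .., y_k of x appear as    *)
(* their eta-expansions, hence the conversions in [rigid_init].               *)
Inductive obj_rigid : seq nat -> seq nat -> nat -> obj -> Prop :=
| rigid_init xs delta x (ys : seq nat) (Ms : seq obj) :
    uniq ys -> {subset ys <= delta} -> size Ms = size ys ->
    (forall j, j < size ys -> obj_conv (Var (nth 0 ys j)) (nth (Var 0) Ms j)) ->
    obj_rigid xs delta x (apps (Var x) Ms)
| rigid_app xs delta x y (Ms : seq obj) j :
    y \notin xs -> j < size Ms ->
    obj_rigid xs delta x (nth (Var 0) Ms j) ->
    obj_rigid xs delta x (apps (Var y) Ms)
| rigid_lam xs delta x A M :
    obj_rigid (map succn xs) (0 :: map succn delta) x.+1 M ->
    obj_rigid xs delta x (Lam A M).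

Inductive fam_rigid : seq nat -> nat -> fam -> Prop :=
| rigid_base xs x c (Ms : seq obj) j :
    j < size Ms -> obj_rigid xs [::] x (nth (Var 0) Ms j) ->
    fam_rigid xs x (fapps (FVar c) Ms)
| rigid_pi xs x A B :
    fam_rigid (0 :: map succn xs) x.+1 B -> fam_rigid xs x (Pi A B).

(* The context x_1 : B_1, .., x_n : B_n, where B_j is in scope                *)
(* G, x_1, .., x_{j-1}.                                                       *)
Definition tele_ctx (Bs : seq fam) : ctx := rev (map DObj Bs).

(* The index of x_{j+1} in scope G, x_1, .., x_n, D, with D declaring d       *)
(* object variables.                                                          *)
Definition xvar (d n j : nat) : nat := d + (n - j.+1).

(* Main.v *)
Require Import Defs.
From Stdlib Require Import Relations.
From mathcomp Require Import all_boot zify.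

Set Implicit Arguments.
Unset Strict Implicit.
Unset Printing Implicit Defensive.

(* The N_j need not be typable, so everything rests on raw conversion.  On    *)
(* raw terms beta and eta together make the domain annotations of lambdas     *)
(* irrelevant, hence conversion is conversion of the annotation-erased terms, *)
(* which is confluent although the annotated calculus is not.                 *)
(*   Descending along the path to a rigid occurrence x_i y_1 .. y_k, the      *)
(* canonical typing of A and that of (the long form of) A[N] stay in step,    *)
(* because every head passed is a variable that the substitution fixes.  One  *)
(* arrives at a canonical M : C convertible to N_i y_1 .. y_k, where the type *)
(* of y_j is convertible to the j-th domain of B_i instantiated by N and      *)
(* y_1, .., y_{j-1}.  Canonical expressions are beta-normal, so erasing them  *)
(* and comparing free variables shows that M, C and the types of the y_j      *)
(* mention no local variable other than the y_j; abstracting M over the y_j   *)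
(* gives the canonical form of N_i in Gamma.  Ill-typed N_j with j <> i do no *)
(* harm, and no normalization theorem is needed: all normal forms come from   *)
(* the given derivations.                                                     *)

(** * Erased terms and their reduction *)

(** Write $\sigma$ for the substitution of $\vec N$ for $\vec x$. Two canonical derivations are
    inverted side by side: that of [A] and that of the long form of $A\sigma$. At a head outside
    $\vec x$, which $\sigma$ sends to a variable, confluence of erased terms ([church_rosser])
    forces the second expression to have the image of that head and arguments convertible to the
    substituted ones ([econv_tapps_inj]). The two types of the head are again related by $\sigma$
    ([crel_head], and [crel_fam_head] for the family at the root), and [econv_inst] hands this
    relation on to the types of the arguments. So the induction on rigidity, [rigid_obj_solved],
    maintains a pair $M : C$ and $M' : C'$ with $M' \equiv M\sigma$ and $C' \equiv C\sigma$.

    It ends at $x_i\,y_1\cdots y_k$, where $M' \equiv N_i\,y_1\cdots y_k$ with distinct local $y_j$.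
    By eta, $N_i \equiv \lambda y_1\ldots y_k.M'$, and what remains is that this abstraction is
    typable in $\Gamma$ alone ([abstract_pattern]). [eta_var_type] identifies the type of each $y_j$
    with an instance of a domain of $B_i$. Since canonical terms are beta-normal, [okt_econv] bounds
    the free variables of $M'$ and of these types by the variables of $\Gamma$ and the $y_j$;
    [typing_ok] extends the bound to the annotations; [typing_ren] transports the derivation along a
    renaming that is meaningful on those variables only.

    All equations are handled on erased terms, because conversion of annotated terms and of their
    erasures coincide ([obj_conv_econv], [econv_obj_conv] and their versions for families). *)

Inductive tm : Type :=
| TVar of nat
| TFam of fname
| TLam of tm
| TApp of tm & tm
| TPi of tm & tm.

Fixpoint tren (r : nat -> nat) (t : tm) : tm :=
  match t with
  | TVar k => TVar (r k)
  | TFam u => TFam u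
  | TLam t => TLam (tren (up_ren r) t)
  | TApp t s => TApp (tren r t) (tren r s)
  | TPi t s => TPi (tren r t) (tren (up_ren r) s)
  end.

Definition tup (s : nat -> tm) (k : nat) : tm :=
  if k is k'.+1 then tren succn (s k') else TVar 0.

Fixpoint tsubst (s : nat -> tm) (t : tm) : tm :=
  match t with
  | TVar k => s k
  | TFam u => TFam u
  | TLam t => TLam (tsubst (tup s) t)
  | TApp t1 t2 => TApp (tsubst s t1) (tsubst s t2)
  | TPi t1 t2 => TPi (tsubst s t1) (tsubst (tup s) t2)
  end.

Definition tinst (ts : seq tm) (k : nat) : tm :=
  nth (TVar (k - size ts)) (rev ts) k.

Lemma eq_up_ren r r' : r =1 r' -> up_ren r =1 up_ren r'.
Proof. by move=> E [|k] //=; rewrite E. Qed.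

Lemma eq_tup s s' : s =1 s' -> tup s =1 tup s'.
Proof. by move=> E [|k] //=; rewrite E. Qed.

Lemma eq_tsubst s s' t : s =1 s' -> tsubst s t = tsubst s' t.
Proof.
elim: t s s' => [k|u|t IH|t1 IH1 t2 IH2|t1 IH1 t2 IH2] s s' E //=.
- by rewrite (IH _ _ (eq_tup E)).
- by rewrite (IH1 _ _ E) (IH2 _ _ E).
- by rewrite (IH1 _ _ E) (IH2 _ _ (eq_tup E)).
Qed.

Lemma tren_tsubst r t : tren r t = tsubst (fun k => TVar (r k)) t.
Proof.
elim: t r => [k|u|t IH|t1 IH1 t2 IH2|t1 IH1 t2 IH2] r //=.
- by rewrite IH; congr TLam; apply: eq_tsubst => -[|k].
- by rewrite IH1 IH2.
- by rewrite IH1 IH2; congr TPi; apply: eq_tsubst => -[|k].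
Qed.

Lemma eq_tren r r' t : r =1 r' -> tren r t = tren r' t.
Proof. by move=> E; rewrite !tren_tsubst; apply: eq_tsubst => k; rewrite E. Qed.

Lemma tsubst_tren s r t : tsubst s (tren r t) = tsubst (fun k => s (r k)) t.
Proof.
elim: t s r => [k|u|t IH|t1 IH1 t2 IH2|t1 IH1 t2 IH2] s r //=.
- by rewrite IH; congr TLam; apply: eq_tsubst => -[|k].
- by rewrite IH1 IH2.
- by rewrite IH1 IH2; congr TPi; apply: eq_tsubst => -[|k].
Qed.

Lemma tren_comp r r' t : tren r (tren r' t) = tren (fun k => r (r' k)) t.
Proof. by rewrite tren_tsubst tsubst_tren -tren_tsubst. Qed.

Lemma tren_of_tsubst r s t : tren r (tsubst s t) = tsubst (fun k => tren r (s k)) t.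
Proof.
elim: t s r => [k|u|t IH|t1 IH1 t2 IH2|t1 IH1 t2 IH2] s r //=.
- rewrite IH; congr TLam; apply: eq_tsubst => -[|k] //=; by rewrite !tren_comp.
- by rewrite IH1 IH2.
- rewrite IH1 IH2; congr TPi; apply: eq_tsubst => -[|k] //=; by rewrite !tren_comp.
Qed.

Lemma tsubst_comp s s' t :
  tsubst s (tsubst s' t) = tsubst (fun k => tsubst s (s' k)) t.
Proof.
have E s0 s1 k : tsubst (tup s0) (tup s1 k) = tup (fun k => tsubst s0 (s1 k)) k.
  by case: k => //= k; rewrite tsubst_tren tren_of_tsubst.
elim: t s s' => [k|u|t IH|t1 IH1 t2 IH2|t1 IH1 t2 IH2] s s' //=.
- by rewrite IH; congr TLam; apply: eq_tsubst.
- by rewrite IH1 IH2.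
- by rewrite IH1 IH2; congr TPi; apply: eq_tsubst.
Qed.

Lemma tsubst_id s t : s =1 TVar -> tsubst s t = t.
Proof.
elim: t s => [k|u|t IH|t1 IH1 t2 IH2|t1 IH1 t2 IH2] s E //=.
- by rewrite IH // => -[|k] //=; rewrite E.
- by rewrite IH1 // IH2.
- by rewrite IH1 // IH2 // => -[|k] //=; rewrite E.
Qed.

Lemma tren_id r t : r =1 id -> tren r t = t.
Proof. by move=> E; rewrite tren_tsubst tsubst_id // => k; rewrite E. Qed.

Lemma iter_tupE k s v :
  iter k tup s v = if v < k then TVar v else tren (addn k) (s (v - k)).
Proof.
elim: k v => [|k IH] v /=; first by rewrite subn0 tren_id.
by case: v => //= v; rewrite IH ltnS subSS; case: ifP => //= _; rewrite tren_comp.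
Qed.

Lemma iter_up_renE k r v :
  iter k up_ren r v = if v < k then v else k + r (v - k).
Proof.
elim: k v => [|k IH] v /=; first by rewrite subn0.
by case: v => //= v; rewrite IH ltnS subSS; case: ifP.
Qed.

Lemma tinstE ts k :
  tinst ts k = if k < size ts then nth (TVar 0) ts (size ts - k.+1)
               else TVar (k - size ts).
Proof.
rewrite /tinst; case: ltnP => h; last by rewrite nth_default // size_rev.
by rewrite nth_rev // (set_nth_default (TVar 0)) //; lia.
Qed.

(** * Free variables and family names of erased terms *)

Definition up_pred (P : nat -> Prop) (k : nat) : Prop :=
  if k is k'.+1 then P k' else True.

Fixpoint okt (P : nat -> Prop) (F : fname -> Prop) (t : tm) : Prop :=
  match t with
  | TVar k => P k
  | TFam u => F u
  | TLam t => okt (up_pred P) F t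
  | TApp t s => okt P F t /\ okt P F s
  | TPi t s => okt P F t /\ okt (up_pred P) F s
  end.

Lemma up_pred_sub (P Q : nat -> Prop) :
  (forall k, P k -> Q k) -> forall k, up_pred P k -> up_pred Q k.
Proof. by move=> h [|k] //=; apply: h. Qed.

Lemma okt_sub (P Q : nat -> Prop) F t :
  (forall k, P k -> Q k) -> okt P F t -> okt Q F t.
Proof.
elim: t P Q => [k|u|t IH|t1 IH1 t2 IH2|t1 IH1 t2 IH2] P Q h /=; first exact: h.
- by [].
- exact: (IH _ _ (up_pred_sub h)).
- by case=> /(IH1 _ _ h) ? /(IH2 _ _ h).
- by case=> /(IH1 _ _ h) ? /(IH2 _ _ (up_pred_sub h)).
Qed.

Lemma okt_tren P F r t : okt P F (tren r t) <-> okt (fun k => P (r k)) F t.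
Proof.
have E (P0 : nat -> Prop) r0 k :
    up_pred P0 (up_ren r0 k) <-> up_pred (fun k => P0 (r0 k)) k by case: k.
elim: t P r => [k|u|t IH|t1 IH1 t2 IH2|t1 IH1 t2 IH2] P r //=.
- by rewrite IH; split; apply: okt_sub => k /E.
- by rewrite IH1 IH2.
- by rewrite IH1 IH2; split=> -[? h]; split=> //; apply: okt_sub h => k /E.
Qed.

Lemma okt_tsubst (P Q : nat -> Prop) F s t :
  okt P F t -> (forall k, P k -> okt Q F (s k)) -> okt Q F (tsubst s t).
Proof.
have E (P0 Q0 : nat -> Prop) s0 : (forall k, P0 k -> okt Q0 F (s0 k)) ->
    forall k, up_pred P0 k -> okt (up_pred Q0) F (tup s0 k).
  by move=> h [|k] //= /h; rewrite okt_tren.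
elim: t P Q s => [k|u|t IH|t1 IH1 t2 IH2|t1 IH1 t2 IH2] P Q s /= ok h.
- exact: h.
- by [].
- exact: IH ok (E _ _ _ h).
- by case: ok => /IH1 h1 /IH2 h2; split; [apply: h1|apply: h2].
- by case: ok => /IH1 h1 /IH2 h2; split; [apply: h1|apply: h2 (E _ _ _ h)].
Qed.

Lemma eq_tren_ok (P : nat -> Prop) F r r' t :
  okt P F t -> (forall k, P k -> r k = r' k) -> tren r t = tren r' t.
Proof.
have E (P0 : nat -> Prop) r0 r1 : (forall k, P0 k -> r0 k = r1 k) ->
    forall k, up_pred P0 k -> up_ren r0 k = up_ren r1 k.
  by move=> h [|k] //= /h ->.
elim: t P r r' => [k|u|t IH|t1 IH1 t2 IH2|t1 IH1 t2 IH2] P r r' /= ok h.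
- by rewrite h.
- by [].
- by rewrite (IH _ _ _ ok (E _ _ _ h)).
- by case: ok => o1 o2; rewrite (IH1 _ _ _ o1 h) (IH2 _ _ _ o2 h).
- by case: ok => o1 o2; rewrite (IH1 _ _ _ o1 h) (IH2 _ _ _ o2 (E _ _ _ h)).
Qed.

Lemma okt_true t : okt (fun _ => True) (fun _ => True) t.
Proof.
have : forall t P, (forall k, P k) -> okt P (fun _ => True) t; last exact.
elim=> [k|u|t0 IH|t1 IH1 t2 IH2|t1 IH1 t2 IH2] P h //=; first by apply: IH => -[|k] /=.
- by split; [apply: IH1|apply: IH2].
- by split; [apply: IH1|apply: IH2 => -[|k] /=].
Qed.

Lemma tren_succn_inj t t' : tren succn t = tren succn t' -> t = t'.
Proof. by move/(congr1 (tren predn)); rewrite !tren_comp !tren_id. Qed.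

Lemma okt_strengthen F t : okt (fun k => 0 < k) F t -> t = tren succn (tren predn t).
Proof.
move=> ok; rewrite tren_comp -[LHS](@tren_id id) //.
by apply: eq_tren_ok ok _ => -[|k].
Qed.

(** Only 0 is sent to 0 by [up_ren r], so $t$ avoids the variable 0 because its renaming does. This
    lets an eta-redex be read back through a renaming. *)
Lemma tren_up_inv r t s :
  tren (up_ren r) t = tren succn s ->
  exists t', t = tren succn t' /\ s = tren r t'.
Proof.
move=> E; exists (tren predn t).
have Et : t = tren succn (tren predn t).
  apply: (@okt_strengthen (fun _ => True)).
  have : okt (fun k => 0 < k) (fun _ => True) (tren (up_ren r) t).
    by rewrite E okt_tren; apply: okt_sub (okt_true _).
  by rewrite okt_tren; apply: okt_sub => -[|k].
split=> //; apply: tren_succn_inj; rewrite -E {1}Et !tren_comp.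
by apply: eq_tren.
Qed.

(** * Parallel beta-eta reduction and its diamond property *)

Definition tscons (s : tm) (k : nat) : tm := if k is k'.+1 then TVar k' else s.

Inductive par : tm -> tm -> Prop :=
| par_var k : par (TVar k) (TVar k)
| par_fam u : par (TFam u) (TFam u)
| par_lam t t' : par t t' -> par (TLam t) (TLam t')
| par_app t t' s s' : par t t' -> par s s' -> par (TApp t s) (TApp t' s')
| par_pi t t' s s' : par t t' -> par s s' -> par (TPi t s) (TPi t' s')
| par_beta t t' s s' : par t t' -> par s s' ->
    par (TApp (TLam t) s) (tsubst (tscons s') t')
| par_eta t t' : par t t' -> par (TLam (TApp (tren succn t) (TVar 0))) t'.

Lemma par_refl t : par t t.
Proof. by elim: t => *; constructor. Qed.

Lemma par_tren r t t' : par t t' -> par (tren r t) (tren r t').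
Proof.
move=> h; elim: h r => {t t'} /=.
- by constructor.
- by constructor.
- by move=> t t' _ IH r; constructor.
- by move=> t t' s s' _ IH1 _ IH2 r; constructor.
- by move=> t t' s s' _ IH1 _ IH2 r; constructor.
- move=> t t' s s' _ IH1 _ IH2 r.
  have -> : tren r (tsubst (tscons s') t') =
            tsubst (tscons (tren r s')) (tren (up_ren r) t').
    by rewrite tren_of_tsubst tsubst_tren; apply: eq_tsubst => -[|k].
  by constructor.
- move=> t t' _ IH r; rewrite tren_comp.
  rewrite -(@eq_tren (fun k => (r k).+1) (fun k => up_ren r k.+1)) // -(tren_comp succn).
  by constructor.
Qed.

Lemma par_tup s s' : (forall k, par (s k) (s' k)) -> forall k, par (tup s k) (tup s' k).
Proof. by move=> h [|k] /=; [constructor | apply: par_tren]. Qed.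

Lemma par_tsubst s s' t t' :
  par t t' -> (forall k, par (s k) (s' k)) -> par (tsubst s t) (tsubst s' t').
Proof.
move=> h; elim: h s s' => {t t'} /=.
- by [].
- by constructor.
- by move=> t t' _ IH s s' /par_tup hs; constructor; apply: IH.
- by move=> t t' u u' _ IH1 _ IH2 s s' hs; constructor; [apply: IH1|apply: IH2].
- by move=> t t' u u' _ IH1 _ IH2 s s' hs; constructor; [apply: IH1|apply: IH2; apply: par_tup].
- move=> t t' u u' _ IH1 _ IH2 s s' hs.
  have -> : tsubst s' (tsubst (tscons u') t') =
            tsubst (tscons (tsubst s' u')) (tsubst (tup s') t').
    rewrite !tsubst_comp; apply: eq_tsubst => -[|k] //=.
    by rewrite tsubst_tren tsubst_id.
  by constructor; [apply: IH1; apply: par_tup|apply: IH2].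
- move=> t t' _ IH s s' hs; rewrite tsubst_tren /=.
  by rewrite -(tren_of_tsubst succn); constructor; apply: IH.
Qed.

Lemma par_tren_inv r t u : par (tren r t) u -> exists t', u = tren r t' /\ par t t'.
Proof.
move: {1 3}(tren r t) (erefl (tren r t)) => w E h; elim: h r t E => {w u}.
- by move=> k r [] //= v [->]; exists (TVar v); split=> //; constructor.
- by move=> u r [] //= v [->]; exists (TFam v); split=> //; constructor.
- move=> t t' _ IH r [] //= v [/esym/esym/IH [v' [-> p]]].
  by exists (TLam v'); split=> //; constructor.
- move=> t t' s s' _ IH1 _ IH2 r [] //= v w [/IH1 [v' [-> p]] /IH2 [w' [-> q]]].
  by exists (TApp v' w'); split=> //; constructor.
- move=> t t' s s' _ IH1 _ IH2 r [] //= v w [/IH1 [v' [-> p]] /IH2 [w' [-> q]]].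
  by exists (TPi v' w'); split=> //; constructor.
- move=> t t' s s' _ IH1 _ IH2 r [] //= [] //= v w [/IH1 [v' [-> p]] /IH2 [w' [-> q]]].
  exists (tsubst (tscons w') v'); split; last by constructor.
  by rewrite tren_of_tsubst tsubst_tren; apply: eq_tsubst => -[|k].
- move=> t t' _ IH r [] //= [] //= v [] //= [|k] [] //.
  move=> /esym/tren_up_inv [v' [-> /IH [v'' [-> p]]]].
  by exists v''; split=> //; constructor.
Qed.

Fixpoint tmsize (t : tm) : nat :=
  match t with
  | TVar _ | TFam _ => 0
  | TLam t => (tmsize t).+1
  | TApp t s | TPi t s => (tmsize t + tmsize s).+1
  end.

Lemma tmsize_tren r t : tmsize (tren r t) = tmsize t.
Proof. by elim: t r => [k|u|t IH|t1 IH1 t2 IH2|t1 IH1 t2 IH2] r //=; rewrite ?IH ?IH1 ?IH2. Qed.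

Lemma tscons0 t : tsubst (tscons (TVar 0)) (tren (up_ren succn) t) = t.
Proof. by rewrite tsubst_tren tsubst_id // => -[|k]. Qed.

(* In the second case the eta redex overlaps a beta redex on its binder.      *)
Lemma par_eta_body t u :
  par (TApp (tren succn t) (TVar 0)) u ->
  (exists2 t', u = TApp (tren succn t') (TVar 0) & par t t') \/
  (exists t0, [/\ t = TLam t0 & par t0 u]).
Proof.
move=> h; inversion h as [| | |a b c d p q| |a b c d p q e|]; subst.
- left; case/par_tren_inv: p => t' [-> p]; exists t' => //.
  by inversion q.
- right; case: t e h => //= t [ea] _; exists t; split=> //.
  subst a; case/par_tren_inv: p => t' [-> p].
  by inversion q; subst; rewrite tscons0.
Qed.

(** The induction is on size rather than on terms or derivations: the contractum of an eta-redex is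
    a subterm only up to a shift, and a shift preserves the size. *)
Lemma par_diamond t t1 t2 : par t t1 -> par t t2 -> exists u, par t1 u /\ par t2 u.
Proof.
move: {2}(tmsize t).+1 (ltnSn (tmsize t)) => n.
elim: n t t1 t2 => // n IH t t1 t2 hn.
(* First critical pair: an eta-contraction against a step inside the body of the same
   abstraction. *)
have lam_eta s s1 b : tmsize s < n -> par s s1 -> par (TApp (tren succn s) (TVar 0)) b ->
    exists u, par s1 u /\ par (TLam b) u.
  move=> hs p /par_eta_body [[s2 -> q]|[s0 [es q]]].
  - by have [u [pu qu]] := IH _ _ _ hs p q; exists u; split=> //; constructor.
  - by apply: (IH s) => //; rewrite es; constructor.
(* Second critical pair: a beta-contraction against a congruence step in which the function itself
   may be eta-contracted. *)
have app_beta l l1 b s s1 s2 : tmsize l + tmsize s < n -> par (TLam l) b -> par l l1 ->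
    par s s1 -> par s s2 ->
    exists u, par (TApp b s2) u /\ par (tsubst (tscons s1) l1) u.
  move=> hs pb pl p q.
  have [w [w1 w2]] : exists u, par s1 u /\ par s2 u by apply: IH p q; lia.
  inversion pb as [| |? l2 pl2| | | |a a' pa]; subst.
  - have [u [pu qu]] : exists u, par l1 u /\ par l2 u by apply: IH pl pl2; lia.
    exists (tsubst (tscons w) u); split; first by constructor.
    by apply: par_tsubst => // -[|k] //=; constructor.
  - rewrite /= tmsize_tren in hs.
    case: (par_eta_body pl) => [[a2 -> qa]|[a0 [ea qa]]].
    + have [u [pu qu]] : exists u, par b u /\ par a2 u by apply: IH pa qa; lia.
      exists (TApp u w); split; first by constructor.
      rewrite /= tsubst_tren tsubst_id //; by constructor.
    (* The function is the eta-expansion of [TLam a0]; both results are then reducts of the smaller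
       redex [TApp (TLam a0) s]. *)
    + subst a; apply: (IH (TApp (TLam a0) s)); first by move: hs => /=; lia.
      * by constructor.
      * by constructor.
move=> p q; inversion p as [k|u|a a' pa|a a' b b' pa pb|a a' b b' pa pb|a a' b b' pa pb|a a' pa];
  subst; inversion q as [k'|u'|c c' pc|c c' d d' pc pd|c c' d d' pc pd|c c' d d' pc pd|c c' pc];
  subst; move: hn => /= hn.
- by exists (TVar k); split; constructor.
- by exists (TFam u); split; constructor.
- have [|u [pu qu]] := IH _ _ _ _ pa pc; first lia.
  by exists (TLam u); split; constructor.
- have [|u [pu qu]] := lam_eta _ _ _ _ pc pa; first by move: hn; rewrite /= tmsize_tren; lia.
  by exists u.
- have [|u [pu qu]] := IH _ _ _ _ pa pc; first lia.
  have [|v [pv qv]] := IH _ _ _ _ pb pd; first lia.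
  by exists (TApp u v); split; constructor.
- by apply: app_beta pa pc pd pb; move: hn => /=; lia.
- have [|u [pu qu]] := IH _ _ _ _ pa pc; first lia.
  have [|v [pv qv]] := IH _ _ _ _ pb pd; first lia.
  by exists (TPi u v); split; constructor.
- have [|u [pu qu]] := app_beta _ _ _ _ _ _ _ pc pa pb pd; first by move: hn => /=; lia.
  by exists u.
- have [|u [pu qu]] := IH _ _ _ _ pa pc; first lia.
  have [|v [pv qv]] := IH _ _ _ _ pb pd; first lia.
  exists (tsubst (tscons v) u); split; apply: par_tsubst => // -[|k] //=; exact: par_var.
- by apply: (lam_eta a) => //; move: hn; rewrite /= tmsize_tren; lia.
- move/tren_succn_inj: H => E; subst c.
  by apply: IH pa pc; move: hn; rewrite /= tmsize_tren; lia.
Qed.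

(** * Erased conversion *)

Definition pars : relation tm := clos_refl_trans tm par.
Definition econv : relation tm := clos_refl_sym_trans tm par.

Lemma pars_ind' (Q : tm -> tm -> Prop) :
  (forall t, Q t t) -> (forall t s u, par t s -> pars s u -> Q s u -> Q t u) ->
  forall t u, pars t u -> Q t u.
Proof.
move=> h0 h1 t u h; elim: {h}(clos_rt_rt1n _ _ _ _ h) => {t u} // t s u p q IH.
by apply: h1 p _ IH; apply: clos_rt1n_rt.
Qed.

Lemma pars_strip t t1 t2 : par t t1 -> pars t t2 -> exists u, pars t1 u /\ par t2 u.
Proof.
move=> p q; move: t1 p; elim/pars_ind': q => {t t2} [t t1 p|t s u p q IH t1 p1].
  by exists t1; split=> //; apply: rt_refl.
have [v [v1 v2]] := par_diamond p p1.
have [w [w1 w2]] := IH _ v1.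
by exists w; split=> //; apply: rt_trans w1; apply: rt_step.
Qed.

Lemma pars_confluent t t1 t2 :
  pars t t1 -> pars t t2 -> exists u, pars t1 u /\ pars t2 u.
Proof.
move=> p; move: t2; elim/pars_ind': p => {t t1} [t t2 p|t s u p q IH t2 p2].
  by exists t2; split=> //; apply: rt_refl.
have [v [v1 v2]] := pars_strip p p2.
have [w [w1 w2]] := IH _ v1.
by exists w; split=> //; apply: rt_trans w2; apply: rt_step.
Qed.

Lemma church_rosser t t' : econv t t' -> exists u, pars t u /\ pars t' u.
Proof.
elim=> {t t'} [t t' p|t|t t' _ [u [u1 u2]]|t s u _ [v [v1 v2]] _ [w [w1 w2]]].
- by exists t'; split; [apply: rt_step|apply: rt_refl].
- by exists t; split; apply: rt_refl.
- by exists u.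
- have [z [z1 z2]] := pars_confluent v2 w1.
  by exists z; split; [apply: rt_trans z1|apply: rt_trans z2].
Qed.

Lemma econv_refl t : econv t t. Proof. exact: rst_refl. Qed.
Lemma econv_sym t t' : econv t t' -> econv t' t. Proof. exact: rst_sym. Qed.
Lemma econv_trans t s u : econv t s -> econv s u -> econv t u.
Proof. exact: rst_trans. Qed.
Lemma par_econv t t' : par t t' -> econv t t'. Proof. exact: rst_step. Qed.
#[local] Hint Resolve econv_refl par_refl : core.

Lemma econv_map (f : tm -> tm) t t' :
  (forall s s', par s s' -> par (f s) (f s')) -> econv t t' -> econv (f t) (f t').
Proof.
move=> h; elim=> {t t'} [t t' p|t|t t' _ IH|t s u _ IH1 _ IH2].
- by apply: par_econv; apply: h.
- exact: econv_refl.
- exact: econv_sym.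
- exact: econv_trans IH1 IH2.
Qed.

Lemma econv_lam t t' : econv t t' -> econv (TLam t) (TLam t').
Proof. by apply: econv_map => *; constructor. Qed.

Lemma econv_app t t' s s' : econv t t' -> econv s s' -> econv (TApp t s) (TApp t' s').
Proof.
move=> h1 h2; apply: (@econv_trans _ (TApp t' s)).
  by apply: (@econv_map (fun t => TApp t s)) h1 => *; constructor.
by apply: (@econv_map (TApp t')) h2 => *; constructor.
Qed.

Lemma econv_pi t t' s s' : econv t t' -> econv s s' -> econv (TPi t s) (TPi t' s').
Proof.
move=> h1 h2; apply: (@econv_trans _ (TPi t' s)).
  by apply: (@econv_map (fun t => TPi t s)) h1 => *; constructor.
by apply: (@econv_map (TPi t')) h2 => *; constructor.
Qed.

Lemma econv_tren r t t' : econv t t' -> econv (tren r t) (tren r t').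
Proof. by apply: econv_map => s s'; apply: par_tren. Qed.

Lemma econv_tsubstl s t t' : econv t t' -> econv (tsubst s t) (tsubst s t').
Proof. by apply: econv_map => u u' h; apply: par_tsubst. Qed.

Lemma econv_tsubstr s s' t :
  (forall k, econv (s k) (s' k)) -> econv (tsubst s t) (tsubst s' t).
Proof.
have E s0 s1 : (forall k, econv (s0 k) (s1 k)) -> forall k, econv (tup s0 k) (tup s1 k).
  by move=> h [|k] //=; apply: econv_tren.
elim: t s s' => [k|u|t IH|t1 IH1 t2 IH2|t1 IH1 t2 IH2] s s' h //=.
- by apply: econv_lam; apply: IH; apply: E.
- by apply: econv_app; [apply: IH1|apply: IH2].
- by apply: econv_pi; [apply: IH1|apply: IH2; apply: E].
Qed.

Lemma econv_tsubst s s' t t' :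
  econv t t' -> (forall k, econv (s k) (s' k)) -> econv (tsubst s t) (tsubst s' t').
Proof.
by move=> h1 h2; apply: (econv_trans (econv_tsubstr _ h2)); apply: econv_tsubstl.
Qed.

Lemma econv_eta t : econv (TLam (TApp (tren succn t) (TVar 0))) t.
Proof. by apply: par_econv; constructor. Qed.

(** Weaken both sides and apply them to the fresh variable 0; the redex on the left contracts back
    to $t$. *)
Lemma econv_lam_inv t s :
  econv (TLam t) s -> econv t (TApp (tren succn s) (TVar 0)).
Proof.
move/(econv_tren succn) => h.
apply: econv_trans (econv_app h (econv_refl (TVar 0))) => /=.
apply: econv_sym; rewrite -{2}[t]tscons0.
by apply: par_econv; constructor.
Qed.

Lemma econv_lam_inj t t' : econv (TLam t) (TLam t') -> econv t t'.
Proof.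
move/econv_lam_inv => h; apply: econv_trans h _ => /=.
by rewrite -{2}[t']tscons0; apply: par_econv; constructor.
Qed.

(** * Inversion of conversion for applied atoms and products *)

Definition tapps (t : tm) (ts : seq tm) : tm := foldl TApp t ts.
Definition tpis (ts : seq tm) (t : tm) : tm := foldr TPi t ts.
Definition tlams (n : nat) (t : tm) : tm := iter n TLam t.

Lemma tapps_rcons t ts s : tapps t (rcons ts s) = TApp (tapps t ts) s.
Proof. by rewrite /tapps foldl_rcons. Qed.

Definition atom (t : tm) : bool :=
  match t with TVar _ | TFam _ => true | _ => false end.

Lemma tapps_inj h h' ts ts' :
  atom h -> atom h' -> tapps h ts = tapps h' ts' -> h = h' /\ ts = ts'.
Proof.
move=> ah ah'; elim/last_ind: ts ts' => [|ts t IH] ts'; elim/last_ind: ts' => [|ts' t' _] //;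
  rewrite ?tapps_rcons /=; [by move=> E; move: ah; rewrite E..| |].
  by move=> E; move: ah'; rewrite -E.
by case=> /IH [-> ->] ->.
Qed.

Lemma tapps_lam h ts t : atom h -> tapps h ts <> TLam t.
Proof. by move=> ah; elim/last_ind: ts => [|ts s _]; rewrite ?tapps_rcons //= => E; move: ah; rewrite E. Qed.

Lemma tapps_pi h ts t s : atom h -> tapps h ts <> TPi t s.
Proof. by move=> ah; elim/last_ind: ts => [|ts u _]; rewrite ?tapps_rcons //= => E; move: ah; rewrite E. Qed.

Definition econvs (ts ts' : seq tm) : Prop :=
  size ts = size ts' /\ forall j, econv (nth (TVar 0) ts j) (nth (TVar 0) ts' j).

Lemma econvs_sym ts ts' : econvs ts ts' -> econvs ts' ts.
Proof. by case=> h1 h2; split=> // j; apply: econv_sym. Qed.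

Lemma econvs_trans ts ss us : econvs ts ss -> econvs ss us -> econvs ts us.
Proof. by case=> h1 h2 [h3 h4]; split=> [|j]; [rewrite h1|apply: econv_trans (h2 j) _]. Qed.

Lemma econvs_rcons ts ts' t t' :
  econvs ts ts' -> econv t t' -> econvs (rcons ts t) (rcons ts' t').
Proof.
case=> h1 h2 h; split=> [|j]; first by rewrite !size_rcons h1.
by rewrite !nth_rcons h1; case: ifP => // _; case: ifP.
Qed.

Lemma econvs_take j ts ts' : econvs ts ts' -> econvs (take j ts) (take j ts').
Proof.
case=> h1 h2; split=> [|i]; first by rewrite !size_take h1.
have [h|h] := ltnP i j; first by rewrite !nth_take.
by rewrite !nth_default // size_take; case: ifP => //; move=> /negbT; lia.
Qed.

Lemma tinst_econv ts ts' : econvs ts ts' -> forall k, econv (tinst ts k) (tinst ts' k).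
Proof. by case=> h1 h2 k; rewrite !tinstE h1; case: ifP. Qed.

Lemma tapps_econv t t' ts ts' :
  econv t t' -> econvs ts ts' -> econv (tapps t ts) (tapps t' ts').
Proof.
move=> ht; elim/last_ind: ts ts' => [|ts s IH] ts'; elim/last_ind: ts' => [|ts' s' _] //;
  try by case; rewrite size_rcons.
case; rewrite !size_rcons => -[h1] h2; rewrite !tapps_rcons; apply: econv_app.
  apply: IH; split=> // j; have := h2 j; rewrite !nth_rcons h1.
  by case: (ltnP j) => // h _; rewrite !nth_default ?h1.
by have := h2 (size ts'); rewrite !nth_rcons h1 ltnn eqxx.
Qed.

Lemma par_tapps h ts u :
  atom h -> par (tapps h ts) u -> exists us, u = tapps h us /\ econvs ts us.
Proof.
move=> ah; elim/last_ind: ts u => [|ts t IH] u.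
  by case: h ah => //= k _ p; inversion p; subst; exists [::].
rewrite tapps_rcons => p; inversion p as [| | |a a' b b' pa pb| |a a' b b' pa pb e|]; subst.
  have [us [-> hu]] := IH _ pa; exists (rcons us b'); rewrite tapps_rcons.
  by split=> //; apply: econvs_rcons hu (par_econv pb).
by case: (tapps_lam ah (esym e)).
Qed.

Lemma pars_tapps h ts u :
  atom h -> pars (tapps h ts) u -> exists us, u = tapps h us /\ econvs ts us.
Proof.
move=> ah; move E: (tapps h ts) => t p; elim/pars_ind': p ts E => {t u} [t|t s u p _ IH] ts E.
  by exists ts.
subst t; have [us [/esym/IH [vs [-> hv]] hu]] := par_tapps ah p.
by exists vs; split=> //; apply: econvs_trans hu hv.
Qed.

(** An atom at the head is never contracted, so every reduct keeps it and reduces the arguments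
    separately; compare two such spines at a common reduct. *)
Lemma econv_tapps_inj h h' ts ts' :
  atom h -> atom h' -> econv (tapps h ts) (tapps h' ts') -> h = h' /\ econvs ts ts'.
Proof.
move=> ah ah' /church_rosser [u [/(pars_tapps ah) [us [E hu]] /(pars_tapps ah') [us' [E' hu']]]].
rewrite E in E'; case: (tapps_inj ah ah' E') => -> E''; subst us'; split=> //.
by apply: econvs_trans hu (econvs_sym hu').
Qed.

Lemma pars_pi t s u :
  pars (TPi t s) u -> exists t' s', [/\ u = TPi t' s', econv t t' & econv s s'].
Proof.
move E: (TPi t s) => v p; elim/pars_ind': p t s E => {v u} [v|v w u p _ IH] t s E; subst.
  by exists t, s.
inversion p as [| | | |a a' b b' pa pb| |]; subst.
have [t' [s' [-> ? ?]]] := IH _ _ erefl; exists t', s'; split=> //.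
- by apply: econv_trans (par_econv pa) _.
- by apply: econv_trans (par_econv pb) _.
Qed.

Lemma econv_pi_inj t t' s s' : econv (TPi t s) (TPi t' s') -> econv t t' /\ econv s s'.
Proof.
move=> /church_rosser [u [/pars_pi [a [b [-> ha hb]]] /pars_pi [a' [b' [[<- <-] ha' hb']]]]].
by split; [apply: econv_trans ha (econv_sym _)|apply: econv_trans hb (econv_sym _)].
Qed.

Lemma econv_pi_tapps t s h ts : atom h -> ~ econv (TPi t s) (tapps h ts).
Proof.
move=> ah /church_rosser [u [/pars_pi [a [b [-> ha hb]]] /(pars_tapps ah) [us [E _]]]].
exact: (tapps_pi ah (esym E)).
Qed.

Lemma econv_tpis_inj ts ts' t t' : size ts = size ts' ->
  econv (tpis ts t) (tpis ts' t') -> econvs ts ts' /\ econv t t'.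
Proof.
elim: ts ts' => [|a ts IH] [|a' ts'] //= [/IH h] /econv_pi_inj [ha /h [[h1 h2] ht]].
by split=> //; split=> [|[|j]] //=; rewrite h1.
Qed.

Lemma tpis_econv ts ts' t t' :
  econvs ts ts' -> econv t t' -> econv (tpis ts t) (tpis ts' t').
Proof.
move=> h ht; elim: ts ts' h => [|a ts IH] [|a' ts'] //= [] // [h1] h2.
by apply: econv_pi; [apply: (h2 0)|apply: IH; split=> // j; apply: (h2 j.+1)].
Qed.

(** * Beta-normal erased terms and their free variables *)

Definition is_lam (t : tm) : bool := if t is TLam _ then true else false.

Fixpoint tnormal (t : tm) : bool :=
  match t with
  | TVar _ | TFam _ => true
  | TLam t => tnormal t
  | TApp t s => [&& ~~ is_lam t, tnormal t & tnormal s]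
  | TPi t s => tnormal t && tnormal s
  end.

Lemma tnormal_tren r t : tnormal (tren r t) = tnormal t.
Proof.
elim: t r => [k|u|t IH|t1 IH1 t2 IH2|t1 IH1 t2 IH2] r //=; rewrite ?IH1 ?IH2 //.
by case: (t1).
Qed.

Lemma tnormal_tapps h ts : atom h -> tnormal (tapps h ts) = all tnormal ts.
Proof.
move=> ah; elim/last_ind: ts => [|ts t IH]; first by case: h ah.
rewrite tapps_rcons all_rcons /= IH [X in _ = X]andbC.
suff -> : ~~ is_lam (tapps h ts) by [].
by case E: (tapps h ts) => [||s||] //; case: (tapps_lam ah E).
Qed.

(* A beta-normal term has only eta-reducts, and eta-reduction preserves the   *)
(* free variables exactly.                                                    *)
Lemma par_tnormal P F t t' : tnormal t -> par t t' ->
  [/\ tnormal t', (~~ is_lam t -> ~~ is_lam t') & okt P F t' -> okt P F t].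
Proof.
move=> n p; elim: p P n => {t t'} //=.
- by move=> t t' _ IH P n; have [? _ ?] := IH (up_pred P) n.
- move=> t t' s s' _ IH1 _ IH2 P /and3P [h /IH1 n1 /IH2 n2].
  have [? h1 ?] := n1 P; have [? _ ?] := n2 P; split=> //; last by case; auto.
  by apply/and3P; split=> //; apply: h1.
- move=> t t' s s' _ IH1 _ IH2 P /andP [/IH1 n1 /IH2 n2].
  have [? h1 ?] := n1 P; have [? _ ?] := n2 (up_pred P); split=> //; last by case; auto.
  by apply/andP; split.
- move=> t t' _ IH P; rewrite tnormal_tren andbT => /andP [_ n].
  have [? _ h] := IH P n; split=> // /h ok; split=> //; by rewrite okt_tren.
Qed.

Lemma okt_par P F t t' : par t t' -> okt P F t -> okt P F t'.
Proof.
move=> p; elim: p P => {t t'} //=.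
- by move=> t t' _ IH P; apply: IH.
- by move=> t t' s s' _ IH1 _ IH2 P [/IH1 ? /IH2 ?].
- by move=> t t' s s' _ IH1 _ IH2 P [/IH1 ? /IH2 ?].
- move=> t t' s s' _ IH1 _ IH2 P [/IH1 h1 /IH2 h2].
  by apply: okt_tsubst h1 _ => -[|k] /=.
- by move=> t t' _ IH P [h _]; apply: IH; move: h; rewrite okt_tren.
Qed.

(** Go through a common reduct: reduction from $t'$ adds no free variable, and reduction from the
    beta-normal $t$ is eta only, hence loses none. *)
Lemma okt_econv P F t t' : tnormal t -> econv t t' -> okt P F t' -> okt P F t.
Proof.
move=> n /church_rosser [u [p q]] ok.
have {q ok} : okt P F u.
  by elim/pars_ind': q ok => // a b c h _ IH /(okt_par h).
elim/pars_ind': p n => // a b c h _ IH n.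
by have [n' _ h'] := par_tnormal P F n h => /(IH n')/h'.
Qed.

(** * Erasure of annotated expressions *)

Fixpoint er_o (M : obj) : tm :=
  match M with
  | Var k => TVar k
  | Lam _ M => TLam (er_o M)
  | App M N => TApp (er_o M) (er_o N)
  end.

(** Domains of products are kept: only the annotations of abstractions are irrelevant for
    conversion. *)
Fixpoint er_f (A : fam) : tm :=
  match A with
  | FVar u => TFam u
  | Pi A B => TPi (er_f A) (er_f B)
  | FLam _ B => TLam (er_f B)
  | FApp A M => TApp (er_f A) (er_o M)
  end.

(* The choice of [TFam 0] for the kind "type" is immaterial. *)
Fixpoint er_k (K : kind) : tm :=
  match K with
  | KType => TFam 0
  | KPi A K => TPi (er_f A) (er_k K)
  end.

Scheme obj_mut_ind := Induction for obj Sort Prop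
  with fam_mut_ind := Induction for fam Sort Prop.
Combined Scheme obj_fam_ind from obj_mut_ind, fam_mut_ind.

Lemma er_o_ren r M : er_o (obj_ren r M) = tren r (er_o M).
Proof. by elim: M r => //= [A M IH|M IH1 N IH2] r; rewrite ?IH ?IH1 ?IH2. Qed.

Lemma er_f_ren r A : er_f (fam_ren r A) = tren r (er_f A).
Proof.
by elim: A r => //= [A IH1 B IH2|A _ B IH|A IH M] r; rewrite ?IH ?IH1 ?IH2 ?er_o_ren.
Qed.

Lemma er_k_ren r K : er_k (kind_ren r K) = tren r (er_k K).
Proof. by elim: K r => //= A K IH r; rewrite IH er_f_ren. Qed.

Lemma er_up s k : er_o (up s k) = tup (fun k => er_o (s k)) k.
Proof. by case: k => //= k; rewrite er_o_ren. Qed.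

Lemma er_iter_up n s k : er_o (iter n up s k) = iter n tup (fun k => er_o (s k)) k.
Proof. by elim: n k => //= n IH k; rewrite er_up; apply: eq_tup. Qed.

Lemma er_o_subst s M : er_o (obj_subst s M) = tsubst (fun k => er_o (s k)) (er_o M).
Proof.
elim: M s => //= [A M IH|M IH1 N IH2] s; rewrite ?IH ?IH1 ?IH2 //.
by congr TLam; apply: eq_tsubst => k; rewrite er_up.
Qed.

Lemma er_f_subst s A : er_f (fam_subst s A) = tsubst (fun k => er_o (s k)) (er_f A).
Proof.
elim: A s => //= [A IH1 B IH2|A _ B IH|A IH M] s; rewrite ?IH ?IH1 ?IH2 ?er_o_subst //.
- by congr TPi; apply: eq_tsubst => k; rewrite er_up.
- by congr TLam; apply: eq_tsubst => k; rewrite er_up.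
Qed.

Lemma er_k_subst s K : er_k (kind_subst s K) = tsubst (fun k => er_o (s k)) (er_k K).
Proof.
elim: K s => //= A K IH s; rewrite IH er_f_subst; congr TPi.
by apply: eq_tsubst => k; rewrite er_up.
Qed.

Lemma er_inst Ns k : er_o (inst Ns k) = tinst (map er_o Ns) k.
Proof.
rewrite /inst /tinst size_map -map_rev.
have [h|h] := ltnP k (size (rev Ns)).
  by rewrite (set_nth_default (Var 0)) // -(nth_map _ (TVar 0)) //; apply: set_nth_default; rewrite size_map.
by rewrite !nth_default // size_map.
Qed.

Lemma er_apps M Ns : er_o (apps M Ns) = tapps (er_o M) (map er_o Ns).
Proof. by elim/last_ind: Ns => //= Ns N IH; rewrite /apps foldl_rcons map_rcons tapps_rcons /= -IH. Qed.

Lemma er_fapps A Ns : er_f (fapps A Ns) = tapps (er_f A) (map er_o Ns).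
Proof. by elim/last_ind: Ns => //= Ns N IH; rewrite /fapps foldl_rcons map_rcons tapps_rcons /= -IH. Qed.

Lemma er_pis Bs A : er_f (pis Bs A) = tpis (map er_f Bs) (er_f A).
Proof. by elim: Bs => //= B Bs ->. Qed.

Lemma er_kpis Bs K : er_k (kpis Bs K) = tpis (map er_f Bs) (er_k K).
Proof. by elim: Bs => //= B Bs ->. Qed.


Lemma okt_er_o F M : okt (fun _ => True) F (er_o M).
Proof.
have : forall M P, (forall k, P k) -> okt P F (er_o M); last exact.
elim=> [k|A {}M IH|{}M IH1 N IH2] P h //=.
- by apply: IH => -[|k] /=.
- by split; [apply: IH1|apply: IH2].
Qed.

Scheme obj_red_mut := Minimality for obj_red Sort Prop
  with fam_red_mut := Minimality for fam_red Sort Prop.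
Combined Scheme obj_fam_red_ind from obj_red_mut, fam_red_mut.

Lemma er_subst1 (t : tm) N : tsubst (fun k => er_o (inst [:: N] k)) t = tsubst (tscons (er_o N)) t.
Proof. by apply: eq_tsubst => -[|k] //=; rewrite er_inst tinstE /= subn1. Qed.

Lemma red_par e :
  (forall M M', obj_red e M M' -> par (er_o M) (er_o M')) /\
  (forall A A', fam_red e A A' -> par (er_f A) (er_f A')).
Proof.
apply: obj_fam_red_ind => //=; try by move=> *; constructor.
- by move=> _ M N; rewrite er_o_subst er_subst1; constructor.
- by move=> _ M _; rewrite er_o_ren; constructor.
- by move=> _ M N; rewrite er_f_subst er_subst1; constructor.
- by move=> _ M _; rewrite er_f_ren; constructor.
Qed.

Lemma obj_conv_econv M M' : obj_conv M M' -> econv (er_o M) (er_o M').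
Proof.
elim=> {M M'} [M M' /(red_par true).1 h|//|M M' _|M1 M2 M3 _ h1 _]; first exact: par_econv.
- exact: econv_sym.
- exact: econv_trans.
Qed.

Lemma fam_conv_econv A A' : fam_conv A A' -> econv (er_f A) (er_f A').
Proof.
elim=> {A A'} [A A' /(red_par true).2 h|//|A A' _|A1 A2 A3 _ h1 _]; first exact: par_econv.
- exact: econv_sym.
- exact: econv_trans.
Qed.

Lemma kind_conv_econv K K' : kind_conv K K' -> econv (er_k K) (er_k K').
Proof. by elim=> //= A {}K A' {}K' /fam_conv_econv h _; apply: econv_pi. Qed.

Lemma beta_nf_econv A A' : beta_nf A A' -> econv (er_f A) (er_f A').
Proof.
case=> h _; elim: h => [B B' /(red_par false).2 h|//|A1 A2 A3 _ h1 _]; first exact: par_econv.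
exact: econv_trans.
Qed.

Lemma crst_map (T U : Type) (R : relation T) (S : relation U) (f : T -> U) :
  (forall x y, R x y -> S (f x) (f y)) ->
  forall x y, clos_refl_sym_trans T R x y -> clos_refl_sym_trans U S (f x) (f y).
Proof.
move=> h x y; elim=> {x y} [x y /h|x|x y _|x y z _ h1 _].
- exact: rst_step.
- exact: rst_refl.
- exact: rst_sym.
- exact: rst_trans.
Qed.

Lemma obj_conv_app M M' N N' :
  obj_conv M M' -> obj_conv N N' -> obj_conv (App M N) (App M' N').
Proof.
move=> h1 h2; apply: (@rst_trans _ _ _ (App M' N)).
- by apply: (@crst_map _ _ _ _ (fun M => App M N)) h1 => *; constructor.
- by apply: (@crst_map _ _ _ _ (App M')) h2 => *; constructor.
Qed.

Lemma fam_conv_app A A' N N' :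
  fam_conv A A' -> obj_conv N N' -> fam_conv (FApp A N) (FApp A' N').
Proof.
move=> h1 h2; apply: (@rst_trans _ _ _ (FApp A' N)).
- by apply: (@crst_map _ _ _ _ (fun A => FApp A N)) h1 => *; constructor.
- by apply: (@crst_map _ _ _ _ (FApp A')) h2 => *; constructor.
Qed.

Lemma fam_conv_pi A A' B B' :
  fam_conv A A' -> fam_conv B B' -> fam_conv (Pi A B) (Pi A' B').
Proof.
move=> h1 h2; apply: (@rst_trans _ _ _ (Pi A' B)).
- by apply: (@crst_map _ _ _ _ (fun A => Pi A B)) h1 => *; constructor.
- by apply: (@crst_map _ _ _ _ (Pi A')) h2 => *; constructor.
Qed.

(** * Conversion of annotated terms *)

Lemma eq_up s s' : s =1 s' -> up s =1 up s'.
Proof. by move=> E [|k] //=; rewrite E. Qed.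

Lemma eq_subst :
  (forall M s s', s =1 s' -> obj_subst s M = obj_subst s' M) /\
  (forall A s s', s =1 s' -> fam_subst s A = fam_subst s' A).
Proof.
apply: obj_fam_ind => //=.
- by move=> A IHA M IHM s s' E; rewrite (IHA _ _ E) (IHM _ _ (eq_up E)).
- by move=> M IHM N IHN s s' E; rewrite (IHM _ _ E) (IHN _ _ E).
- by move=> A IHA B IHB s s' E; rewrite (IHA _ _ E) (IHB _ _ (eq_up E)).
- by move=> A IHA B IHB s s' E; rewrite (IHA _ _ E) (IHB _ _ (eq_up E)).
- by move=> A IHA M IHM s s' E; rewrite (IHA _ _ E) (IHM _ _ E).
Qed.

Lemma ren_as_subst :
  (forall M r, obj_ren r M = obj_subst (fun k => Var (r k)) M) /\
  (forall A r, fam_ren r A = fam_subst (fun k => Var (r k)) A).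
Proof.
have E r : up (fun k => Var (r k)) =1 (fun k => Var (up_ren r k)) by case.
apply: obj_fam_ind => //=.
- by move=> A IHA M IHM r; rewrite IHA IHM (eq_subst.1 _ _ _ (E r)).
- by move=> M IHM N IHN r; rewrite IHM IHN.
- by move=> A IHA B IHB r; rewrite IHA IHB (eq_subst.2 _ _ _ (E r)).
- by move=> A IHA B IHB r; rewrite IHA IHB (eq_subst.2 _ _ _ (E r)).
- by move=> A IHA M IHM r; rewrite IHA IHM.
Qed.

Lemma eq_fam_ren r r' A : r =1 r' -> fam_ren r A = fam_ren r' A.
Proof. by move=> E; rewrite !ren_as_subst.2; apply: eq_subst.2 => k; rewrite E. Qed.

Lemma subst_ren :
  (forall M s r, obj_subst s (obj_ren r M) = obj_subst (fun k => s (r k)) M) /\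
  (forall A s r, fam_subst s (fam_ren r A) = fam_subst (fun k => s (r k)) A).
Proof.
have E s r : (fun k => up s (up_ren r k)) =1 up (fun k => s (r k)) by case.
apply: obj_fam_ind => //=.
- by move=> A IHA M IHM s r; rewrite IHA IHM (eq_subst.1 _ _ _ (E s r)).
- by move=> M IHM N IHN s r; rewrite IHM IHN.
- by move=> A IHA B IHB s r; rewrite IHA IHB (eq_subst.2 _ _ _ (E s r)).
- by move=> A IHA B IHB s r; rewrite IHA IHB (eq_subst.2 _ _ _ (E s r)).
- by move=> A IHA M IHM s r; rewrite IHA IHM.
Qed.

Lemma obj_ren_comp r r' M : obj_ren r (obj_ren r' M) = obj_ren (fun k => r (r' k)) M.
Proof. by rewrite (ren_as_subst.1 _ r) subst_ren.1 -ren_as_subst.1. Qed.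

Lemma fam_ren_comp r r' A : fam_ren r (fam_ren r' A) = fam_ren (fun k => r (r' k)) A.
Proof. by rewrite (ren_as_subst.2 _ r) subst_ren.2 -ren_as_subst.2. Qed.

Lemma ren_subst :
  (forall M s r, obj_ren r (obj_subst s M) = obj_subst (fun k => obj_ren r (s k)) M) /\
  (forall A s r, fam_ren r (fam_subst s A) = fam_subst (fun k => obj_ren r (s k)) A).
Proof.
have E s r : (fun k => obj_ren (up_ren r) (up s k)) =1 up (fun k => obj_ren r (s k)).
  by case=> //= k; rewrite !obj_ren_comp.
apply: obj_fam_ind => //=.
- by move=> A IHA M IHM s r; rewrite IHA IHM (eq_subst.1 _ _ _ (E s r)).
- by move=> M IHM N IHN s r; rewrite IHM IHN.
- by move=> A IHA B IHB s r; rewrite IHA IHB (eq_subst.2 _ _ _ (E s r)).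
- by move=> A IHA B IHB s r; rewrite IHA IHB (eq_subst.2 _ _ _ (E s r)).
- by move=> A IHA M IHM s r; rewrite IHA IHM.
Qed.

Lemma subst_id :
  (forall M s, s =1 Var -> obj_subst s M = M) /\
  (forall A s, s =1 Var -> fam_subst s A = A).
Proof.
have E s : s =1 Var -> up s =1 Var by move=> E [|k] //=; rewrite E.
apply: obj_fam_ind => //=.
- by move=> A IHA M IHM s h; rewrite IHA // IHM //; apply: E.
- by move=> M IHM N IHN s h; rewrite IHM // IHN.
- by move=> A IHA B IHB s h; rewrite IHA // IHB //; apply: E.
- by move=> A IHA B IHB s h; rewrite IHA // IHB //; apply: E.
- by move=> A IHA M IHM s h; rewrite IHA // IHM.
Qed.

Lemma fam_ren_id r A : r =1 id -> fam_ren r A = A.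
Proof. by move=> E; rewrite ren_as_subst.2 subst_id.2 // => k; rewrite E. Qed.

Lemma eq_kind_ren r r' K : r =1 r' -> kind_ren r K = kind_ren r' K.
Proof.
by elim: K r r' => //= A K IH r r' E; rewrite (eq_fam_ren _ E) (IH _ _ (eq_up_ren E)).
Qed.

Lemma kind_ren_comp r r' K : kind_ren r (kind_ren r' K) = kind_ren (fun k => r (r' k)) K.
Proof.
elim: K r r' => //= A K IH r r'; rewrite fam_ren_comp IH; congr KPi.
by apply: eq_kind_ren => -[|k].
Qed.

Lemma kind_ren_id r K : r =1 id -> kind_ren r K = K.
Proof.
elim: K r => //= A K IH r E; rewrite fam_ren_id // IH // => -[|k] //=.
by rewrite E.
Qed.

(* [Lam A ((Lam B M) x)] beta-reduces to [Lam A M] and eta-reduces to         *)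
(* [Lam B M]: conversion of raw terms ignores the domain annotations.         *)
Lemma obj_conv_ann A B M : obj_conv (Lam A M) (Lam B M).
Proof.
apply: (@rst_trans _ _ _ (Lam A (App (obj_ren succn (Lam B M)) (Var 0)))); last first.
  by apply: rst_step; apply: obj_eta.
apply: rst_sym; apply: rst_step; apply: obj_red_lam2.
rewrite -{2}[M](subst_id.1 _ (fun k => inst [:: Var 0] (up_ren succn k))).
  by rewrite -subst_ren.1; apply: obj_beta.
by case=> // k; rewrite /inst nth_default //= subn1.
Qed.

Lemma fam_conv_ann A A' B : fam_conv (FLam A B) (FLam A' B).
Proof.
apply: (@rst_trans _ _ _ (FLam A (FApp (fam_ren succn (FLam A' B)) (Var 0)))); last first.
  by apply: rst_step; apply: fam_eta.
apply: rst_sym; apply: rst_step; apply: fam_red_lam2.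
rewrite -{2}[B](subst_id.2 _ (fun k => inst [:: Var 0] (up_ren succn k))).
  by rewrite -subst_ren.2; apply: fam_beta.
by case=> // k; rewrite /inst nth_default //= subn1.
Qed.

Lemma obj_conv_lam A A' M M' : obj_conv M M' -> obj_conv (Lam A M) (Lam A' M').
Proof.
move=> h; apply: rst_trans (obj_conv_ann A A' M') .
by apply: (@crst_map _ _ _ _ (Lam A)) h => *; constructor.
Qed.

Lemma fam_conv_lam A A' B B' : fam_conv B B' -> fam_conv (FLam A B) (FLam A' B').
Proof.
move=> h; apply: rst_trans (fam_conv_ann A A' B') .
by apply: (@crst_map _ _ _ _ (FLam A)) h => *; constructor.
Qed.

Lemma obj_conv_er M M' : er_o M = er_o M' -> obj_conv M M'.
Proof.
elim: M M' => [k|A M IH|M IHM N IHN] [k'|A' M'|M' N'] //= [].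
- by move=> ->; apply: rst_refl.
- by move/IH; apply: obj_conv_lam.
- by move=> /IHM h1 /IHN h2; apply: obj_conv_app.
Qed.

Lemma fam_conv_er A A' : er_f A = er_f A' -> fam_conv A A'.
Proof.
elim: A A' => [u|A IHA B IHB|A _ B IHB|A IHA M] [u'|A' B'|A' B'|A' M'] //= [].
- by move=> ->; apply: rst_refl.
- by move=> /IHA h1 /IHB h2; apply: fam_conv_pi.
- by move/IHB; apply: fam_conv_lam.
- by move=> /IHA h1 /obj_conv_er h2; apply: fam_conv_app.
Qed.

(** Confluence takes place on erased terms; lifting each step back to a conversion of annotated
    terms is what returns its result to [obj_conv] and [fam_conv]. *)
Lemma par_lift t t' : par t t' ->
  (forall M, er_o M = t -> exists2 M', er_o M' = t' & obj_conv M M') /\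
  (forall A, er_f A = t -> exists2 A', er_f A' = t' & fam_conv A A').
Proof.
elim=> {t t'}.
- by move=> k; split=> X e; exists X => //; apply: rst_refl.
- by move=> k; split=> X e; exists X => //; apply: rst_refl.
- move=> t t' _ [IH1 IH2]; split=> -[] //.
  + move=> A M /= [/IH1 [M' <- h]]; exists (Lam A M') => //; exact: obj_conv_lam.
  + move=> A B /= [/IH2 [M' <- h]]; exists (FLam A M') => //; exact: fam_conv_lam.
- move=> t t' s s' _ [IH1 IH2] _ [IH3 IH4]; split=> -[] //.
  + move=> M N /= [/IH1 [M' <- h] /IH3 [N' <- h']]; exists (App M' N') => //; exact: obj_conv_app.
  + move=> M N /= [/IH2 [M' <- h] /IH3 [N' <- h']]; exists (FApp M' N') => //; exact: fam_conv_app.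
- move=> t t' s s' _ [IH1 IH2] _ [IH3 IH4]; split=> -[] //.
  move=> M N /= [/IH2 [M' <- h] /IH4 [N' <- h']]; exists (Pi M' N') => //; exact: fam_conv_pi.
- move=> t t' s s' _ [IH1 IH2] _ [IH3 IH4]; split=> -[] //.
  + move=> [] //= A M N [/IH1 [M' <- h] /IH3 [N' <- h']].
    exists (obj_subst (inst [:: N']) M'); first by rewrite er_o_subst er_subst1.
    apply: rst_trans (obj_conv_app (obj_conv_lam A A h) h') _.
    by apply: rst_step; apply: obj_beta.
  + move=> [] //= A M N [/IH2 [M' <- h] /IH3 [N' <- h']].
    exists (fam_subst (inst [:: N']) M'); first by rewrite er_f_subst er_subst1.
    apply: rst_trans (fam_conv_app (fam_conv_lam A A h) h') _.
    by apply: rst_step; apply: fam_beta.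
- move=> t t' _ [IH1 IH2]; split=> -[] //.
  + move=> A [] //= M [] // k [e1 e2].
    (* [M] need not be a shift, since its annotations may mention the bound variable.
       [obj_ren predn M], shifted again, is one with the same erasure as [M], hence convertible to
       it. *)
    have e3 : er_o (obj_ren predn M) = t by rewrite er_o_ren e1 tren_comp tren_id.
    have [M' e4 h] := IH1 _ e3; exists M' => //; apply: rst_trans h.
    apply: (@rst_trans _ _ _ (Lam A (App (obj_ren succn (obj_ren predn M)) (Var 0)))).
      by apply: obj_conv_er; rewrite /= e1 e2 er_o_ren e3.
    by apply: rst_step; apply: obj_eta.
  + move=> A [] //= M [] // k [e1 e2].
    have e3 : er_f (fam_ren predn M) = t by rewrite er_f_ren e1 tren_comp tren_id.
    have [M' e4 h] := IH2 _ e3; exists M' => //; apply: rst_trans h.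
    apply: (@rst_trans _ _ _ (FLam A (FApp (fam_ren succn (fam_ren predn M)) (Var 0)))).
      by apply: fam_conv_er; rewrite /= e1 e2 er_f_ren e3.
    by apply: rst_step; apply: fam_eta.
Qed.

Lemma pars_lift t t' : pars t t' ->
  (forall M, er_o M = t -> exists2 M', er_o M' = t' & obj_conv M M') /\
  (forall A, er_f A = t -> exists2 A', er_f A' = t' & fam_conv A A').
Proof.
elim/pars_ind' => {t t'}.
  by move=> t; split=> X e; exists X => //; apply: rst_refl.
move=> t s u /par_lift [h1 h2] _ [IH1 IH2]; split=> X.
- by move=> /h1 [Y /IH1 [Z e h] h']; exists Z => //; apply: rst_trans h' h.
- by move=> /h2 [Y /IH2 [Z e h] h']; exists Z => //; apply: rst_trans h' h.
Qed.

Lemma econv_obj_conv M M' : econv (er_o M) (er_o M') -> obj_conv M M'.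
Proof.
move=> /church_rosser [u [/pars_lift [/(_ _ erefl) [X e h] _] /pars_lift [/(_ _ erefl) [X' e' h'] _]]].
apply: rst_trans h _; apply: rst_trans (rst_sym _ _ _ _ h').
by apply: obj_conv_er; rewrite e e'.
Qed.

Lemma econv_fam_conv A A' : econv (er_f A) (er_f A') -> fam_conv A A'.
Proof.
move=> /church_rosser [u [/pars_lift [_ /(_ _ erefl) [X e h]] /pars_lift [_ /(_ _ erefl) [X' e' h']]]].
apply: rst_trans h _; apply: rst_trans (rst_sym _ _ _ _ h').
by apply: fam_conv_er; rewrite e e'.
Qed.

(** * Free variables of annotated expressions, annotations included *)

Fixpoint oko (P : nat -> Prop) (F : fname -> Prop) (M : obj) : Prop :=
  match M with
  | Var k => P k
  | Lam A M => okf P F A /\ oko (up_pred P) F M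
  | App M N => oko P F M /\ oko P F N
  end
with okf (P : nat -> Prop) (F : fname -> Prop) (A : fam) : Prop :=
  match A with
  | FVar u => F u
  | Pi A B => okf P F A /\ okf (up_pred P) F B
  | FLam A B => okf P F A /\ okf (up_pred P) F B
  | FApp A M => okf P F A /\ oko P F M
  end.

Fixpoint okk (P : nat -> Prop) (F : fname -> Prop) (K : kind) : Prop :=
  match K with
  | KType => True
  | KPi A K => okf P F A /\ okk (up_pred P) F K
  end.

Lemma ok_sub (F F' : fname -> Prop) : (forall u, F u -> F' u) ->
  (forall M (P Q : nat -> Prop), (forall k, P k -> Q k) -> oko P F M -> oko Q F' M) /\
  (forall A (P Q : nat -> Prop), (forall k, P k -> Q k) -> okf P F A -> okf Q F' A).
Proof.
move=> hF; apply: obj_fam_ind => /=.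
- by move=> k P Q h; apply: h.
- by move=> A IHA M IHM P Q h [/(IHA _ _ h) ? /(IHM _ _ (up_pred_sub h))].
- by move=> M IHM N IHN P Q h [/(IHM _ _ h) ? /(IHN _ _ h)].
- by move=> u P Q _; apply: hF.
- by move=> A IHA B IHB P Q h [/(IHA _ _ h) ? /(IHB _ _ (up_pred_sub h))].
- by move=> A IHA B IHB P Q h [/(IHA _ _ h) ? /(IHB _ _ (up_pred_sub h))].
- by move=> A IHA M IHM P Q h [/(IHA _ _ h) ? /(IHM _ _ h)].
Qed.

Lemma oko_sub (P Q : nat -> Prop) F M : (forall k, P k -> Q k) -> oko P F M -> oko Q F M.
Proof. exact: (ok_sub (fun u (h : F u) => h)).1. Qed.

Lemma okf_sub (P Q : nat -> Prop) F A : (forall k, P k -> Q k) -> okf P F A -> okf Q F A.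
Proof. exact: (ok_sub (fun u (h : F u) => h)).2. Qed.

Lemma okk_sub (P Q : nat -> Prop) F K : (forall k, P k -> Q k) -> okk P F K -> okk Q F K.
Proof.
elim: K P Q => //= A K IH P Q h [/(okf_sub h) ? ok]; split=> //.
by apply: IH ok; apply: up_pred_sub.
Qed.

Lemma up_pred_ren (P : nat -> Prop) r k :
  up_pred P (up_ren r k) <-> up_pred (fun k => P (r k)) k.
Proof. by case: k. Qed.

Lemma ok_ren F :
  (forall M P r, oko P F (obj_ren r M) <-> oko (fun k => P (r k)) F M) /\
  (forall A P r, okf P F (fam_ren r A) <-> okf (fun k => P (r k)) F A).
Proof.
have Eo M P r : oko (fun k => up_pred P (up_ren r k)) F M <-> oko (up_pred (fun k => P (r k))) F M.
  by split; apply: oko_sub => k /up_pred_ren.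
have Ef A P r : okf (fun k => up_pred P (up_ren r k)) F A <-> okf (up_pred (fun k => P (r k))) F A.
  by split; apply: okf_sub => k /up_pred_ren.
apply: obj_fam_ind => //=.
- by move=> A IHA M IHM P r; rewrite IHA IHM Eo.
- by move=> M IHM N IHN P r; rewrite IHM IHN.
- by move=> A IHA B IHB P r; rewrite IHA IHB Ef.
- by move=> A IHA B IHB P r; rewrite IHA IHB Ef.
- by move=> A IHA M IHM P r; rewrite IHA IHM.
Qed.

Lemma okk_ren P F r K : okk P F (kind_ren r K) <-> okk (fun k => P (r k)) F K.
Proof.
elim: K P r => //= A K IH P r; rewrite (ok_ren F).2 IH.
by split=> -[? h]; split=> //; apply: okk_sub h => k /up_pred_ren.
Qed.

Lemma ok_subst F :
  (forall M (P Q : nat -> Prop) s, oko P F M -> (forall k, P k -> oko Q F (s k)) ->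
     oko Q F (obj_subst s M)) /\
  (forall A (P Q : nat -> Prop) s, okf P F A -> (forall k, P k -> oko Q F (s k)) ->
     okf Q F (fam_subst s A)).
Proof.
have E (P Q : nat -> Prop) s : (forall k, P k -> oko Q F (s k)) ->
    forall k, up_pred P k -> oko (up_pred Q) F (up s k).
  by move=> h [|k] //= /h; rewrite (ok_ren F).1.
apply: obj_fam_ind => //=.
- by move=> k P Q s ok h; apply: h.
- move=> A IHA M IHM P Q s [/IHA h1 /IHM h2] h.
  by split; [apply: h1|apply: h2; apply: E].
- by move=> A IHA M IHM P Q s [/IHA h1 /IHM h2] h; split; [apply: h1|apply: h2].
- move=> A IHA M IHM P Q s [/IHA h1 /IHM h2] h.
  by split; [apply: h1|apply: h2; apply: E].
- move=> A IHA M IHM P Q s [/IHA h1 /IHM h2] h.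
  by split; [apply: h1|apply: h2; apply: E].
- by move=> A IHA M IHM P Q s [/IHA h1 /IHM h2] h; split; [apply: h1|apply: h2].
Qed.

Lemma ok_red F :
  (forall M M', obj_red false M M' -> forall P, oko P F M -> oko P F M') /\
  (forall A A', fam_red false A A' -> forall P, okf P F A -> okf P F A').
Proof.
have E P N : oko P F N -> forall k, up_pred P k -> oko P F (inst [:: N] k).
  by move=> h [|k] //= hk; rewrite /inst nth_default //= subn1.
apply: obj_fam_red_ind => //=; try by move=> > _ IH P [h1 h2]; split=> //; apply: IH.
- by move=> A M N P [[_ h] hN]; apply: (ok_subst F).1 h _; apply: E.
- by move=> A M N P [[_ h] hN]; apply: (ok_subst F).2 h _; apply: E.
Qed.

Lemma okf_beta_nf P F A A' : beta_nf A A' -> okf P F A -> okf P F A'.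
Proof.
by case=> h _; elim: h => [B B' /(ok_red F).2 /(_ P)|//|B B' B'' _ h1 _ h2 /h1/h2].
Qed.

Lemma eq_ren_ok F :
  (forall M (P : nat -> Prop) r r', oko P F M -> (forall k, P k -> r k = r' k) ->
     obj_ren r M = obj_ren r' M) /\
  (forall A (P : nat -> Prop) r r', okf P F A -> (forall k, P k -> r k = r' k) ->
     fam_ren r A = fam_ren r' A).
Proof.
have E (P : nat -> Prop) r r' : (forall k, P k -> r k = r' k) ->
    forall k, up_pred P k -> up_ren r k = up_ren r' k by move=> h [|k] //= /h ->.
apply: obj_fam_ind => //=.
- by move=> k P r r' ok ->.
- by move=> A IHA M IHM P r r' [h1 h2] h; rewrite (IHA _ _ _ h1 h) (IHM _ _ _ h2 (E _ _ _ h)).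
- by move=> A IHA M IHM P r r' [h1 h2] h; rewrite (IHA _ _ _ h1 h) (IHM _ _ _ h2 h).
- by move=> A IHA M IHM P r r' [h1 h2] h; rewrite (IHA _ _ _ h1 h) (IHM _ _ _ h2 (E _ _ _ h)).
- by move=> A IHA M IHM P r r' [h1 h2] h; rewrite (IHA _ _ _ h1 h) (IHM _ _ _ h2 (E _ _ _ h)).
- by move=> A IHA M IHM P r r' [h1 h2] h; rewrite (IHA _ _ _ h1 h) (IHM _ _ _ h2 h).
Qed.

Lemma oko_er P F M : oko P F M -> okt P F (er_o M).
Proof. by elim: M P => //= [A M IH|M IH1 N IH2] P [] ; [move=> _; apply: IH|move=> /IH1 ? /IH2]. Qed.

Lemma okf_er P F A : okf P F A -> okt P F (er_f A).
Proof.
elim: A P => //= [A IHA B IHB|A _ B IHB|A IHA M] P [] //.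
- by move=> /IHA ? /IHB.
- by move=> _ /IHB.
- by move=> /IHA ? /oko_er.
Qed.

Lemma oko_apps P F M Ns : oko P F (apps M Ns) <->
  oko P F M /\ (forall j, j < size Ns -> oko P F (nth (Var 0) Ns j)).
Proof.
elim/last_ind: Ns => [|Ns N IH]; first by split=> [//|[]].
rewrite /apps foldl_rcons /= IH size_rcons; split.
- case=> -[h1 h2] h3; split=> // j; rewrite ltnS nth_rcons leq_eqVlt.
  by case: ltngtP => //= h _; apply: h2.
- case=> h1 h2; split.
    by split=> // j h; have := h2 j; rewrite nth_rcons h ltnS ltnW //; apply.
  by have := h2 (size Ns); rewrite nth_rcons ltnn eqxx; apply.
Qed.

Lemma okf_fapps P F A Ns : okf P F (fapps A Ns) <->
  okf P F A /\ (forall j, j < size Ns -> oko P F (nth (Var 0) Ns j)).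
Proof.
elim/last_ind: Ns => [|Ns N IH]; first by split=> [//|[]].
rewrite /fapps foldl_rcons /= IH size_rcons; split.
- case=> -[h1 h2] h3; split=> // j; rewrite ltnS nth_rcons leq_eqVlt.
  by case: ltngtP => //= h _; apply: h2.
- case=> h1 h2; split.
    by split=> // j h; have := h2 j; rewrite nth_rcons h ltnS ltnW //; apply.
  by have := h2 (size Ns); rewrite nth_rcons ltnn eqxx; apply.
Qed.

Lemma okf_pis P F Bs A : okf P F (pis Bs A) <->
  (forall j, j < size Bs -> okf (iter j up_pred P) F (nth (FVar 0) Bs j)) /\
  okf (iter (size Bs) up_pred P) F A.
Proof.
elim: Bs P => [|B Bs IH] P /=; first by split=> [//|[]].
rewrite IH -iterSr; split.
- by case=> h1 [h2 h3]; split=> // -[|j] //= hj; rewrite -iterS iterSr; apply: h2.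
- case=> h1 h2; split; first exact: (h1 0).
  by split=> // j hj; rewrite -iterSr; apply: (h1 j.+1).
Qed.

Lemma okk_kpis P F Bs K : okk P F (kpis Bs K) <->
  (forall j, j < size Bs -> okf (iter j up_pred P) F (nth (FVar 0) Bs j)) /\
  okk (iter (size Bs) up_pred P) F K.
Proof.
elim: Bs P => [|B Bs IH] P /=; first by split=> [//|[]].
rewrite IH -iterSr; split.
- by case=> h1 [h2 h3]; split=> // -[|j] //= hj; rewrite -iterS iterSr; apply: h2.
- case=> h1 h2; split; first exact: (h1 0).
  by split=> // j hj; rewrite -iterSr; apply: (h1 j.+1).
Qed.

Lemma iter_up_predE n P k : iter n up_pred P k <-> (k < n \/ P (k - n)).
Proof.
elim: n k => [|n IH] k; first by rewrite subn0; split=> [|[]]; auto.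
case: k => [|k] /=; first by split=> // _; left.
by rewrite IH subSS ltnS.
Qed.

Lemma okt_tapps P F t ts : okt P F (tapps t ts) <->
  okt P F t /\ (forall j, j < size ts -> okt P F (nth (TVar 0) ts j)).
Proof.
elim/last_ind: ts => [|ts s IH]; first by split=> [//|[]].
rewrite tapps_rcons /= IH size_rcons; split.
- case=> -[h1 h2] h3; split=> // j; rewrite ltnS nth_rcons leq_eqVlt.
  by case: ltngtP => //= h _; apply: h2.
- case=> h1 h2; split.
    by split=> // j h; have := h2 j; rewrite nth_rcons h ltnS ltnW //; apply.
  by have := h2 (size ts); rewrite nth_rcons ltnn eqxx; apply.
Qed.

(** * Renaming and free variables in canonical LF *)

Scheme has_kind_mut := Minimality for has_kind Sort Prop
  with has_type_mut := Minimality for has_type Sort Prop.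
Combined Scheme typing_ind from has_kind_mut, has_type_mut.

Lemma typing_ctx_wf :
  (forall G A K, has_kind G A K -> ctx_wf G) /\
  (forall G M A, has_type G M A -> ctx_wf G).
Proof. by apply: typing_ind. Qed.

Lemma fam_dom_cat D G : fam_dom (D ++ G) = fam_dom D ++ fam_dom G.
Proof. exact: pmap_cat. Qed.

Lemma nobj_tele Bs : nobj (tele_ctx Bs) = size Bs.
Proof. by rewrite /nobj /tele_ctx count_rev count_map -(count_predT Bs). Qed.

Lemma fam_dom_tele Bs : fam_dom (tele_ctx Bs) = [::].
Proof.
elim/last_ind: Bs => //= Bs B IH.
by rewrite /tele_ctx map_rcons rev_rcons /=.
Qed.

Lemma obj_in_fun G v T T' : obj_in G v T -> obj_in G v T' -> T = T'.
Proof.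
move=> h; elim: h T' => {G v T}.
- by move=> G A T' h; inversion h.
- by move=> G k A B _ IH T' h; inversion h; subst; rewrite (IH A0).
- by move=> G k A u K _ IH T' h; inversion h; subst; rewrite (IH T').
Qed.

Lemma obj_in_cat D G v T :
  obj_in G v T -> obj_in (D ++ G) (nobj D + v) (fam_ren (addn (nobj D)) T).
Proof.
move=> h; elim: D => [|[A|u K] D IH] /=; first by rewrite fam_ren_id.
- rewrite -(fam_ren_comp succn); exact: obj_in_obj.
- exact: obj_in_fam.
Qed.

Lemma obj_in_cat_inv D G v T : obj_in (D ++ G) v T -> nobj D <= v ->
  exists2 T0, T = fam_ren (addn (nobj D)) T0 & obj_in G (v - nobj D) T0.
Proof.
elim: D v T => [|[A|u K] D IH] v T /=.
- by move=> h _; exists T; rewrite ?fam_ren_id // subn0.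
- rewrite add1n => h hv; inversion h as [? ? e1 e2|? k T' ? h' e1 e2|]; subst => //.
  have [T0 -> h0] := IH _ _ h' hv; exists T0 => //.
  by rewrite fam_ren_comp.
- by rewrite add0n => h hv; inversion h as [| |? ? ? ? ? h']; subst; apply: IH.
Qed.

Lemma fam_in_cat D G u K :
  fam_in G u K -> fam_in (D ++ G) u (kind_ren (addn (nobj D)) K).
Proof.
move=> h; elim: D => [|[A|v L] D IH] /=; first by rewrite kind_ren_id.
- rewrite -(kind_ren_comp succn); exact: fam_in_obj.
- exact: fam_in_fam.
Qed.

Lemma fam_in_cat_inv D G u K : fam_in (D ++ G) u K -> u \notin fam_dom D ->
  exists2 K0, K = kind_ren (addn (nobj D)) K0 & fam_in G u K0.
Proof.
elim: D K => [|[A|v L] D IH] K /=.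
- by move=> h _; exists K; rewrite ?kind_ren_id.
- move=> h hu; inversion h as [|? ? K' ? h'|]; subst.
  have [K0 -> h0] := IH _ h' hu; exists K0 => //.
  by rewrite kind_ren_comp.
- rewrite add0n /= inE negb_or => h /andP [n1 n2].
  inversion h as [|  |? ? ? ? ? h']; subst; last exact: IH.
  by rewrite eqxx in n1.
Qed.

Lemma fam_in_dom G u K : fam_in G u K -> u \in fam_dom G.
Proof. by elim=> {G u K} //= *; rewrite inE ?eqxx //; apply/orP; right. Qed.

Lemma fam_in_fun G u K K' : ctx_wf G -> fam_in G u K -> fam_in G u K' -> K = K'.
Proof.
move=> w h; elim: h K' w => {G u K}.
- move=> G u K K' w h; inversion h as [| |? ? ? ? ? h']; subst => //.
  by inversion w as [| |? ? ? ? n]; subst; rewrite (fam_in_dom h') in n.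
- move=> G u K B h IH K' w h'; inversion w; inversion h'; subst.
  by rewrite (IH K0).
- move=> G u K v L h IH K' w h'; inversion w as [| |? ? ? w' n]; inversion h'; subst.
    by rewrite (fam_in_dom h) in n.
  exact: IH.
Qed.

Lemma fam_dom_wf D G u : ctx_wf (D ++ G) -> u \in fam_dom G -> u \notin fam_dom D.
Proof.
elim: D => [|[A|v K] D IH] //= w hu; inversion w as [|? ? w'|? ? ? w' n]; subst; first exact: IH.
rewrite inE negb_or (IH w' hu) andbT; apply: contraNneq n => <-.
by rewrite fam_dom_cat mem_cat hu orbT.
Qed.

Lemma ctx_wf_cat D G : ctx_wf (D ++ G) -> ctx_wf G.
Proof. by elim: D => [|d D IH] //= w; inversion w; subst; apply: IH. Qed.

(** * Renaming of telescopes and of canonical derivations *)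

Fixpoint ren_tele (r : nat -> nat) (Bs : seq fam) : seq fam :=
  if Bs is B :: Bs' then fam_ren r B :: ren_tele (up_ren r) Bs' else [::].

Lemma size_ren_tele r Bs : size (ren_tele r Bs) = size Bs.
Proof. by elim: Bs r => //= B Bs IH r; rewrite IH. Qed.

Lemma nth_ren_tele r Bs j : nth (FVar 0) (ren_tele r Bs) j =
  fam_ren (iter j up_ren r) (nth (FVar 0) Bs j).
Proof.
by elim: Bs r j => [|B Bs IH] r [|j] //=; rewrite IH -iterSr.
Qed.

Lemma fam_ren_pis r Bs A :
  fam_ren r (pis Bs A) = pis (ren_tele r Bs) (fam_ren (iter (size Bs) up_ren r) A).
Proof. by elim: Bs r => //= B Bs IH r; rewrite IH -iterSr. Qed.

Lemma kind_ren_kpis r Bs :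
  kind_ren r (kpis Bs KType) = kpis (ren_tele r Bs) KType.
Proof. by elim: Bs r => //= B Bs IH r; rewrite IH. Qed.

Lemma fam_ren_pis_inv r B Bs' A' : fam_ren r B = pis Bs' A' ->
  exists Bs A, [/\ B = pis Bs A, Bs' = ren_tele r Bs &
                   A' = fam_ren (iter (size Bs) up_ren r) A].
Proof.
elim: Bs' r B => [|B' Bs' IH] r B /=; first by move=> <-; exists [::], B.
case: B => //= B1 B2 [<- /IH [Bs [A [-> -> ->]]]].
by exists (B1 :: Bs), A; split=> //=; rewrite -iterSr.
Qed.

Lemma instE Ns k :
  inst Ns k = if k < size Ns then nth (Var 0) Ns (size Ns - k.+1)
              else Var (k - size Ns).
Proof.
rewrite /inst; case: ltnP => h; last by rewrite nth_default // size_rev.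
by rewrite nth_rev // (set_nth_default (Var 0)) //; lia.
Qed.

Lemma inst_ren r Ns k :
  obj_ren r (inst Ns k) = inst (map (obj_ren r) Ns) (iter (size Ns) up_ren r k).
Proof.
rewrite !instE iter_up_renE size_map; case: (ltnP k) => h.
  by rewrite h (nth_map (Var 0)) //; lia.
by rewrite ltnNge leq_addr /= addKn.
Qed.

Lemma fam_ren_inst r Ns B : fam_ren r (fam_subst (inst Ns) B) =
  fam_subst (inst (map (obj_ren r) Ns)) (fam_ren (iter (size Ns) up_ren r) B).
Proof. by rewrite ren_subst.2 subst_ren.2; apply: eq_subst.2 => k; rewrite inst_ren. Qed.

Lemma fam_ren_inst_size r Ns B n : size Ns = n -> fam_ren r (fam_subst (inst Ns) B) =
  fam_subst (inst (map (obj_ren r) Ns)) (fam_ren (iter n up_ren r) B).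
Proof. by move=> <-; apply: fam_ren_inst. Qed.

Lemma obj_ren_inst r Ns M : obj_ren r (obj_subst (inst Ns) M) =
  obj_subst (inst (map (obj_ren r) Ns)) (obj_ren (iter (size Ns) up_ren r) M).
Proof. by rewrite ren_subst.1 subst_ren.1; apply: eq_subst.1 => k; rewrite inst_ren. Qed.

Lemma red_ren :
  (forall M M', obj_red false M M' -> forall r, obj_red false (obj_ren r M) (obj_ren r M')) /\
  (forall A A', fam_red false A A' -> forall r, fam_red false (fam_ren r A) (fam_ren r A')).
Proof.
apply: obj_fam_red_ind => //=; try by move=> *; constructor.
- by move=> A M N r; rewrite obj_ren_inst /=; constructor.
- by move=> A M N r; rewrite fam_ren_inst /=; constructor.
Qed.

(** Variables go to variables, so even a non-injective renaming creates no beta-redex; this is why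
    normal forms survive renaming. *)
Lemma red_ren_inv :
  (forall M M', obj_red false M M' -> forall r M0, M = obj_ren r M0 ->
     exists M1, obj_red false M0 M1) /\
  (forall A A', fam_red false A A' -> forall r A0, A = fam_ren r A0 ->
     exists A1, fam_red false A0 A1).
Proof.
apply: obj_fam_red_ind => //=.
- move=> A M N r [] //= [] //= A0 M0 N0 _; eexists; exact: obj_beta.
- by move=> A A' M _ IH r [] //= A0 M0 [/IH [A1 h] _]; eexists; apply: obj_red_lam1 h.
- by move=> A M M' _ IH r [] //= A0 M0 [_ /IH [M1 h]]; eexists; apply: obj_red_lam2 h.
- by move=> M M' N _ IH r [] //= M0 N0 [/IH [M1 h] _]; eexists; apply: obj_red_app1 h.
- by move=> M N N' _ IH r [] //= M0 N0 [_ /IH [N1 h]]; eexists; apply: obj_red_app2 h.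
- move=> A M N r [] //= [] //= A0 M0 N0 _; eexists; exact: fam_beta.
- by move=> A A' B _ IH r [] //= A0 B0 [/IH [A1 h] _]; eexists; apply: fam_red_pi1 h.
- by move=> A B B' _ IH r [] //= A0 B0 [_ /IH [B1 h]]; eexists; apply: fam_red_pi2 h.
- by move=> A A' B _ IH r [] //= A0 B0 [/IH [A1 h] _]; eexists; apply: fam_red_lam1 h.
- by move=> A B B' _ IH r [] //= A0 B0 [_ /IH [B1 h]]; eexists; apply: fam_red_lam2 h.
- by move=> M M' N _ IH r [] //= M0 N0 [/IH [M1 h] _]; eexists; apply: fam_red_app1 h.
- by move=> M N N' _ IH r [] //= M0 N0 [_ /IH [N1 h]]; eexists; apply: fam_red_app2 h.
Qed.

Lemma beta_nf_ren r A A' : beta_nf A A' -> beta_nf (fam_ren r A) (fam_ren r A').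
Proof.
case=> h n; split.
  elim: h {n} => [B B' h|B|B1 B2 B3 _ h1 _ h2]; last exact: rt_trans h1 h2.
    by apply: rt_step; apply: red_ren.2.
  exact: rt_refl.
by move=> X /red_ren_inv.2 /(_ _ _ erefl) [Y /n].
Qed.

Lemma obj_ren_apps r M Ns : obj_ren r (apps M Ns) = apps (obj_ren r M) (map (obj_ren r) Ns).
Proof. by elim/last_ind: Ns => //= Ns N IH; rewrite /apps foldl_rcons map_rcons foldl_rcons /= IH. Qed.

Lemma fam_ren_fapps r A Ns : fam_ren r (fapps A Ns) = fapps (fam_ren r A) (map (obj_ren r) Ns).
Proof. by elim/last_ind: Ns => //= Ns N IH; rewrite /fapps foldl_rcons map_rcons foldl_rcons /= IH. Qed.

Lemma is_base_ren r A : is_base A -> is_base (fam_ren r A).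
Proof. by case=> u [Ms ->]; exists u, (map (obj_ren r) Ms); rewrite fam_ren_fapps. Qed.

Lemma okf_inst P F Ns B : (forall j, j < size Ns -> oko P F (nth (Var 0) Ns j)) ->
  okf (iter (size Ns) up_pred P) F B -> okf P F (fam_subst (inst Ns) B).
Proof.
move=> h1 h2; apply: (ok_subst F).2 h2 _ => k /iter_up_predE h; rewrite instE.
case: ltnP h => hk h; first by apply: h1; lia.
by case: h => //; lia.
Qed.

Lemma okf_inst_take P F Ns Bs j : j < size Bs -> size Ns = size Bs ->
  (forall i, i < j -> oko P F (nth (Var 0) Ns i)) ->
  okf (iter j up_pred P) F (nth (FVar 0) Bs j) ->
  okf P F (fam_subst (inst (take j Ns)) (nth (FVar 0) Bs j)).
Proof.
move=> hj e hN hB; have ej : size (take j Ns) = j by rewrite size_takel // e ltnW.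
apply: okf_inst; rewrite ej // => i hi; rewrite nth_take //; exact: hN.
Qed.

(** The declarations selected by [P] and [F] depend only on each other, so they form a
    self-contained part of the context. *)
Definition ctx_closed (P : nat -> Prop) (F : fname -> Prop) (G : ctx) : Prop :=
  (forall v T, P v -> obj_in G v T -> okf P F T) /\
  (forall u K, F u -> fam_in G u K -> okk P F K).

Definition ctx_ren (P : nat -> Prop) (F : fname -> Prop) (r : nat -> nat) (G H : ctx) : Prop :=
  (forall v T, P v -> obj_in G v T -> obj_in H (r v) (fam_ren r T)) /\
  (forall u K, F u -> fam_in G u K -> fam_in H u (kind_ren r K)).

Lemma ctx_closed_up P F G A :
  okf P F A -> ctx_closed P F G -> ctx_closed (up_pred P) F (DObj A :: G).
Proof.
move=> okA [h1 h2]; split.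
- by move=> v T hv hT; inversion hT as [|? k T' ? h|]; subst; rewrite (ok_ren F).2 //; apply: h1 h.
- by move=> u K hu hK; inversion hK as [|? ? K' ? h|]; subst; rewrite okk_ren //; apply: h2 h.
Qed.

Lemma ctx_ren_up P F r G H A :
  ctx_ren P F r G H -> ctx_ren (up_pred P) F (up_ren r) (DObj A :: G) (DObj (fam_ren r A) :: H).
Proof.
have E B : fam_ren (up_ren r) (fam_ren succn B) = fam_ren succn (fam_ren r B).
  by rewrite !fam_ren_comp.
have Ek K : kind_ren (up_ren r) (kind_ren succn K) = kind_ren succn (kind_ren r K).
  by rewrite !kind_ren_comp.
case=> h1 h2; split.
- move=> v T hv hT; inversion hT; subst; rewrite E; first exact: obj_in_here.
  by apply: obj_in_obj; apply: h1.
- move=> u K hu hK; inversion hK; subst; rewrite Ek.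
  by apply: fam_in_obj; apply: h2.
Qed.

Lemma nth_map_ren r Cs j :
  nth (FVar 0) (map (fam_ren r) Cs) j = fam_ren r (nth (FVar 0) Cs j).
Proof. by elim: Cs j => [|C Cs IH] [|j] //=. Qed.

(** The renaming has to respect declarations on a closed part of the context only, so one induction
    yields weakening, where [P] is everything, and the strengthening and reordering that pattern
    abstraction requires. *)
Lemma typing_ren :
  (forall G A K, has_kind G A K -> K = KType -> forall P F r H,
     ctx_wf H -> ctx_closed P F G -> ctx_ren P F r G H -> okf P F A ->
     has_kind H (fam_ren r A) KType) /\
  (forall G M A, has_type G M A -> forall P F r H,
     ctx_wf H -> ctx_closed P F G -> ctx_ren P F r G H -> oko P F M -> okf P F A ->
     has_type H (obj_ren r M) (fam_ren r A)).
Proof.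
apply: typing_ind => //=.
- move=> G A B _ IHA _ IHB _ P F r H w cl re [okA okB].
  have hA := IHA erefl _ _ _ _ w cl re okA.
  apply: (has_kind_pi hA); apply: (IHB erefl) okB.
  + exact: ctx_wf_obj w hA.
  + exact: ctx_closed_up.
  + exact: ctx_ren_up.
- move=> G u Bs Cs Ns _ hu eN hnf _ IH _ P F r H w cl re.
  rewrite okf_fapps => -[/= ou oN].
  have := cl.2 _ _ ou hu; rewrite okk_kpis => -[oB _].
  have := re.2 _ _ ou hu; rewrite kind_ren_kpis => hu'.
  rewrite fam_ren_fapps /=; apply: (has_kind_backchain (Cs := map (fam_ren r) Cs) w hu').
  + by rewrite size_map size_ren_tele.
  + move=> j; rewrite size_ren_tele => hj; rewrite nth_map_ren nth_ren_tele -map_take.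
    have ej : size (take j Ns) = j by rewrite size_takel // eN ltnW.
    rewrite -(fam_ren_inst_size r _ ej); apply: beta_nf_ren; exact: hnf.
  + move=> j; rewrite size_ren_tele => hj; rewrite nth_map_ren (nth_map (Var 0)) ?eN //.
    apply: (IH _ hj _ _ _ _ w cl re); first by apply: oN; rewrite eN.
    (* The type of an argument is a beta-reduct of a domain instantiated by earlier arguments, so it
       stays inside the closed part. *)
    apply: okf_beta_nf (hnf _ hj) _; apply: okf_inst_take => //; last exact: oB.
    by move=> i hi; apply: oN; lia.
- move=> G A M B _ IHA _ IHM P F r H w cl re [okA okM] [_ okB].
  have hA := IHA erefl _ _ _ _ w cl re okA.
  apply: (has_type_lam hA); apply: IHM okM okB.
  + exact: ctx_wf_obj w hA.
  + exact: ctx_closed_up.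
  + exact: ctx_ren_up.
- move=> G y Bs Cs A A' Ns _ hy bA eN hnf _ IH hA P F r H w cl re.
  rewrite oko_apps => -[/= oy oN] _.
  have := cl.1 _ _ oy hy; rewrite okf_pis => -[oB _].
  have := re.1 _ _ oy hy; rewrite fam_ren_pis => hy'.
  rewrite obj_ren_apps /=.
  apply: (has_type_backchain (Cs := map (fam_ren r) Cs) w hy').
  + exact: is_base_ren.
  + by rewrite size_map size_ren_tele.
  + move=> j; rewrite size_ren_tele => hj; rewrite nth_map_ren nth_ren_tele -map_take.
    have ej : size (take j Ns) = j by rewrite size_takel // eN ltnW.
    rewrite -(fam_ren_inst_size r _ ej); apply: beta_nf_ren; exact: hnf.
  + move=> j; rewrite size_ren_tele => hj; rewrite nth_map_ren (nth_map (Var 0)) ?eN //.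
    apply: (IH _ hj _ _ _ _ w cl re); first by apply: oN; rewrite eN.
    apply: okf_beta_nf (hnf _ hj) _; apply: okf_inst_take => //; last exact: oB.
    by move=> i hi; apply: oN; lia.
  + by rewrite -(fam_ren_inst_size r _ eN); apply: beta_nf_ren.
Qed.

(* Annotations inside a canonical expression are determined by the types of   *)
(* its variables, so they introduce no further variables.                     *)
Lemma typing_ok :
  (forall G A K, has_kind G A K -> K = KType -> forall P F,
     ctx_closed P F G -> okt P F (er_f A) -> okf P F A) /\
  (forall G M A, has_type G M A -> forall P F,
     ctx_closed P F G -> okt P F (er_o M) -> (is_lam (er_o M) -> okf P F A) ->
     oko P F M /\ okf P F A).
Proof.
apply: typing_ind => //=.
- move=> G A B _ IHA _ IHB _ P F cl [okA okB].
  have hA := IHA erefl _ _ cl okA; split=> //.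
  by apply: (IHB erefl) okB; apply: ctx_closed_up.
- move=> G u Bs Cs Ns _ hu eN hnf _ IH _ P F cl.
  rewrite er_fapps okt_tapps size_map okf_fapps => -[/= ou oN]; split=> // j.
  have := cl.2 _ _ ou hu; rewrite okk_kpis => -[oB _].
  (* Strong induction on the position: the type of argument $j$ depends on earlier arguments, whose
     annotations are already bounded. This supplies the bound on the type that is demanded when the
     argument is an abstraction. *)
  rewrite eN; move: j; apply: ltn_ind => j IHj hj.
  apply: proj1; apply: (IH _ hj _ _ cl).
    by have := oN j; rewrite (nth_map (Var 0)) eN //; apply.
  move=> _; apply: okf_beta_nf (hnf _ hj) _; apply: okf_inst_take => //; last exact: oB.
  by move=> i hi; apply: IHj => //; lia.
- move=> G A M B _ IHA _ IHM P F cl okM [] // okA okB; do ?split=> //.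
  by have [] := IHM _ _ (ctx_closed_up okA cl) okM (fun _ => okB).
- move=> G y Bs Cs A A' Ns _ hy bA eN hnf _ IH hA P F cl.
  rewrite er_apps okt_tapps size_map oko_apps => -[/= oy oN] _.
  have := cl.1 _ _ oy hy; rewrite okf_pis => -[oB oA].
  have ok : forall j, j < size Ns -> oko P F (nth (Var 0) Ns j).
    rewrite eN; apply: ltn_ind => j IHj hj.
    apply: proj1; apply: (IH _ hj _ _ cl).
      by have := oN j; rewrite (nth_map (Var 0)) eN //; apply.
    move=> _; apply: okf_beta_nf (hnf _ hj) _; apply: okf_inst_take => //; last exact: oB.
    by move=> i hi; apply: IHj => //; lia.
  split=> //; apply: okf_beta_nf hA _; apply: okf_inst => //; by rewrite eN.
Qed.

Lemma typing_fam_dom :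
  (forall G A K, has_kind G A K -> okf (fun _ => True) (fun u => u \in fam_dom G) A) /\
  (forall G M A, has_type G M A -> oko (fun _ => True) (fun u => u \in fam_dom G) M).
Proof.
have E k : True -> up_pred (fun _ => True) k by case: k.
apply: typing_ind => //=.
- by move=> G A B _ IHA _ IHB; split=> //; apply: okf_sub IHB.
- by move=> G A B K _ IHA _ IHB; split=> //; apply: okf_sub IHB.
- move=> G u Bs Cs Ns _ /fam_in_dom hu eN _ _ IH.
  by rewrite okf_fapps; split=> //; rewrite eN.
- by move=> G A B K _ IHA _ IHB; split=> //; apply: oko_sub IHB.
- move=> G y Bs Cs A A' Ns _ _ _ eN _ _ IH _.
  by rewrite oko_apps; split=> //; rewrite eN.
Qed.

Lemma kind_wf_fam_dom G K :
  kind_wf G K -> okk (fun _ => True) (fun u => u \in fam_dom G) K.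
Proof.
elim=> {G K} //= G A K /typing_fam_dom.1 hA _ IH; split=> //.
by apply: okk_sub IH; case.
Qed.

Lemma okk_mono P (F F' : fname -> Prop) K :
  (forall u, F u -> F' u) -> okk P F K -> okk P F' K.
Proof.
move=> h; elim: K P => //= A K IH P [okA /IH okK]; split=> //.
by apply: (ok_sub h).2 okA.
Qed.

Lemma fam_in_fam_dom G u K :
  ctx_wf G -> fam_in G u K -> okk (fun _ => True) (fun u => u \in fam_dom G) K.
Proof.
move=> w h; elim: h w => {G u K}.
- move=> G u K w; inversion w as [| |? ? ? _ _ hK]; subst.
  by apply: okk_mono (kind_wf_fam_dom hK) => v /=; rewrite inE => ->; rewrite orbT.
- by move=> G u K B _ IH w; inversion w; subst; rewrite okk_ren; apply: IH.
- move=> G u K v L _ IH w; inversion w; subst.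
  by apply: okk_mono (IH _) => // x /=; rewrite inE => ->; rewrite orbT.
Qed.

Lemma ctx_closed_true G : ctx_closed (fun _ => True) (fun _ => True) G.
Proof.
have [h1 h2] : (forall M P, (forall k, P k) -> oko P (fun _ => True) M) /\
               (forall A P, (forall k, P k) -> okf P (fun _ => True) A).
  have E (P : nat -> Prop) : (forall k, P k) -> forall k, up_pred P k by move=> h [].
  by apply: obj_fam_ind => //= *; auto.
split=> [v T _ _|u K _ _]; first exact: h2.
have : forall P : nat -> Prop, (forall k, P k) -> okk P (fun _ => True) K; last exact.
elim: K => //= A K IH P h; split; first exact: h2.
by apply: IH => -[].
Qed.

Lemma okf_true A : okf (fun _ => True) (fun _ => True) A.
Proof. by have := (ctx_closed_true [:: DObj A]).1 0 _ I (obj_in_here _ _); rewrite (ok_ren _).2. Qed.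

Lemma has_kind_weaken G A d : ctx_wf (d :: G) -> has_kind G A KType ->
  has_kind (d :: G) (fam_ren (addn (nobj [:: d])) A) KType.
Proof.
move=> w hA; apply: typing_ren.1 hA erefl _ _ _ _ w (ctx_closed_true G) _ (okf_true A).
split=> [v T _ h|u K _ h].
- exact: (@obj_in_cat [:: d]).
- exact: (@fam_in_cat [:: d]).
Qed.

Lemma obj_in_has_kind G v T : ctx_wf G -> obj_in G v T -> has_kind G T KType.
Proof.
move=> w h; elim: h w => {G v T}.
- by move=> G A w; have /= h := has_kind_weaken w; inversion w; subst; apply: h.
- by move=> G k A B _ IH w; have /= h := has_kind_weaken w; inversion w; subst; apply: h; apply: IH.
- move=> G k A u K _ IH w; have /= h := @has_kind_weaken G A _ w; inversion w; subst.
  by rewrite fam_ren_id in h => //; apply: h; apply: IH.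
Qed.

Lemma typing_normal :
  (forall G A K, has_kind G A K -> tnormal (er_f A)) /\
  (forall G M A, has_type G M A -> tnormal (er_o M)).
Proof.
apply: typing_ind => //=.
- by move=> G A B _ -> _ ->.
- move=> G u Bs Cs Ns _ _ eN _ _ IH; rewrite er_fapps tnormal_tapps //.
  apply/(all_nthP (TVar 0)) => j; rewrite size_map => hj.
  by rewrite (nth_map (Var 0)) //; apply: IH; rewrite -eN.
- move=> G y Bs Cs A A' Ns _ _ _ eN _ _ IH _; rewrite er_apps tnormal_tapps //.
  apply/(all_nthP (TVar 0)) => j; rewrite size_map => hj.
  by rewrite (nth_map (Var 0)) //; apply: IH; rewrite -eN.
Qed.

Lemma tele_ctx_rcons Bs B : tele_ctx (rcons Bs B) = DObj B :: tele_ctx Bs.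
Proof. by rewrite /tele_ctx map_rcons rev_rcons. Qed.

Lemma tele_ctx_cons Bs B G : tele_ctx (B :: Bs) ++ G = tele_ctx Bs ++ DObj B :: G.
Proof. by rewrite /tele_ctx /= rev_cons cat_rcons. Qed.

Lemma obj_in_tele Bs G j : j < size Bs ->
  obj_in (tele_ctx Bs ++ G) (size Bs - j.+1)
         (fam_ren (addn (size Bs - j)) (nth (FVar 0) Bs j)).
Proof.
elim/last_ind: Bs => // Bs B IH; rewrite size_rcons ltnS => hj.
rewrite tele_ctx_rcons nth_rcons /= subSS.
case: ltngtP hj => // h _.
  have -> : size Bs - j = (size Bs - j.+1).+1 by lia.
  rewrite (@eq_fam_ren _ (fun k => (size Bs - j + k).+1)); last by move=> k; lia.
  by rewrite -(fam_ren_comp succn); apply: obj_in_obj; apply: IH.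
rewrite h subnn subSnn (@eq_fam_ren _ succn) //; exact: obj_in_here.
Qed.

(** * Iterated abstractions, spines and inversion of canonical typing *)

Definition lams (Fs : seq fam) (M : obj) : obj := foldr Lam M Fs.

Lemma er_lams Fs M : er_o (lams Fs M) = tlams (size Fs) (er_o M).
Proof. by elim: Fs => //= F Fs ->. Qed.

Lemma has_type_lams Fs G M C :
  has_type (tele_ctx Fs ++ G) M C -> has_type G (lams Fs M) (pis Fs C).
Proof.
elim/last_ind: Fs M C => //= Fs F IH M C; rewrite tele_ctx_rcons /= => h.
rewrite /lams /pis !foldr_rcons; apply: IH; apply: (has_type_lam _ h).
by have := typing_ctx_wf.2 _ _ _ h => w; inversion w.
Qed.

Fixpoint tvars (m : nat) : seq tm := if m is m'.+1 then TVar m' :: tvars m' else [::].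

Lemma size_tvars m : size (tvars m) = m.
Proof. by elim: m => //= m ->. Qed.

Lemma nth_tvars m j : j < m -> nth (TVar 0) (tvars m) j = TVar (m - j.+1).
Proof.
elim: m j => // m IH [|j] hj /=; first by rewrite subSS subn0.
by rewrite IH // subSS.
Qed.

Lemma tren_tapps r t ts : tren r (tapps t ts) = tapps (tren r t) (map (tren r) ts).
Proof. by elim: ts t => //= s ts IH t; rewrite IH. Qed.

Lemma tsubst_tapps s t ts : tsubst s (tapps t ts) = tapps (tsubst s t) (map (tsubst s) ts).
Proof. by elim: ts t => //= u ts IH t; rewrite IH. Qed.

Lemma tlams_econv m t t' : econv t t' -> econv (tlams m t) (tlams m t').
Proof. by move=> h; elim: m => //= m IH; apply: econv_lam. Qed.

Lemma econv_tlams_inv m t s :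
  econv (tlams m t) s -> econv t (tapps (tren (addn m) s) (tvars m)).
Proof.
elim: m t s => [|m IH] t s /=; first by rewrite tren_id.
move=> /econv_lam_inv /IH /=.
by rewrite tren_comp addn0 (@eq_tren _ (addn m.+1)) // => k; rewrite addnS.
Qed.

Lemma econv_tlams_eta m s : econv (tlams m (tapps (tren (addn m) s) (tvars m))) s.
Proof.
elim: m s => [|m IH] s /=; first by rewrite tren_id.
apply: econv_trans (econv_eta s); apply: econv_lam.
have := IH (TApp (tren succn s) (TVar 0)).
by rewrite /= tren_comp addn0 (@eq_tren _ (addn m.+1)) // => k; rewrite addnS.
Qed.

Lemma tmsize_tlams m t : tmsize (tlams m t) = m + tmsize t.
Proof. by elim: m => //= m ->. Qed.

Lemma tmsize_tapps t ts j : j < size ts -> tmsize (nth (TVar 0) ts j) < tmsize (tapps t ts).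
Proof.
elim/last_ind: ts => // ts s IH; rewrite size_rcons tapps_rcons nth_rcons ltnS => hj /=.
by case: (ltngtP j (size ts)) hj => // h _; [have := IH h|]; lia.
Qed.

(** The content of a backchaining step, with beta-normalization of the types weakened to conversion
    of erasures. *)
Definition spine (G : ctx) (z : nat) (Ps : seq obj) (D : fam) : Prop :=
  exists Bs Cs A,
  [/\ obj_in G z (pis Bs A), is_base A, size Ps = size Bs,
      forall j, j < size Bs ->
        has_type G (nth (Var 0) Ps j) (nth (FVar 0) Cs j) /\
        econv (er_f (nth (FVar 0) Cs j))
          (tsubst (tinst (take j (map er_o Ps))) (er_f (nth (FVar 0) Bs j)))
    & econv (er_f D) (tsubst (tinst (map er_o Ps)) (er_f A))].

Lemma has_type_inv G M C : has_type G M C ->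
  (exists A M1 B, [/\ M = Lam A M1, C = Pi A B & has_type (DObj A :: G) M1 B]) \/
  (exists z Ps, M = apps (Var z) Ps /\ spine G z Ps C).
Proof.
case=> {G M C}.
- by move=> G A M B _ h; left; exists A, M, B.
- move=> G y Bs Cs A A' Ns _ hy bA eN hnf hN hA; right; exists y, Ns; split=> //.
  exists Bs, Cs, A; split=> // [j hj|].
    split; first exact: hN.
    have := beta_nf_econv (hnf _ hj); rewrite er_f_subst => /econv_sym h.
    by apply: econv_trans h _; apply: econv_tsubstr => k; rewrite er_inst map_take.
  have := beta_nf_econv hA; rewrite er_f_subst => /econv_sym h.
  by apply: econv_trans h _; apply: econv_tsubstr => k; rewrite er_inst.
Qed.

Lemma apps_inj z z' Ps Ps' : apps (Var z) Ps = apps (Var z') Ps' -> z = z' /\ Ps = Ps'.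
Proof.
elim/last_ind: Ps Ps' => [|Ps P IH] Ps'; elim/last_ind: Ps' => [|Ps' P' _];
  rewrite /apps ?foldl_rcons //=; first by case.
by case=> /IH [-> ->] ->.
Qed.

Lemma has_type_spine G z Ps C : has_type G (apps (Var z) Ps) C -> spine G z Ps C.
Proof.
case/has_type_inv => [[A [M [B [e _ _]]]]|[z' [Ps' [/apps_inj [-> ->] h]]]] //.
by move: e; elim/last_ind: Ps => // Ps P _; rewrite /apps foldl_rcons.
Qed.

(** Base types up to conversion. The property survives substitution, because family names are never
    substituted, and excludes products; it transfers neutrality from one derivation to the other. *)
Definition ebase (t : tm) : Prop := exists u ts, econv t (tapps (TFam u) ts).

Lemma ebase_econv t t' : econv t t' -> ebase t' -> ebase t.
Proof. by move=> h [u [ts h']]; exists u, ts; apply: econv_trans h h'. Qed.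

Lemma ebase_tsubst s t : ebase t -> ebase (tsubst s t).
Proof.
case=> u [ts /(econv_tsubstl s) h]; exists u, (map (tsubst s) ts).
by rewrite tsubst_tapps in h.
Qed.

Lemma ebase_pi t s : ~ ebase (TPi t s).
Proof. by case=> u [ts]; apply: econv_pi_tapps. Qed.

Lemma is_base_ebase A : is_base A -> ebase (er_f A).
Proof. by case=> u [Ms ->]; exists u, (map er_o Ms); rewrite er_fapps. Qed.

Lemma spine_ebase G z Ps D : spine G z Ps D -> ebase (er_f D).
Proof.
case=> Bs [Cs [A [_ bA _ _ h]]]; apply: ebase_econv h _.
by apply: ebase_tsubst; apply: is_base_ebase.
Qed.

Lemma has_type_lams_inv G M C : has_type G M C ->
  exists Fs z Ps D, [/\ M = lams Fs (apps (Var z) Ps), C = pis Fs D &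
                        spine (tele_ctx Fs ++ G) z Ps D].
Proof.
elim: M G C => [k|A M IH|M1 _ M2 _] G C /has_type_inv [[A' [M' [B [e -> h]]]]|[z [Ps [-> h]]]] //;
  try by exists [::], z, Ps, C.
case: e h => <- <- /IH [Fs [z [Ps [D [-> -> h]]]]].
by exists (A :: Fs), z, Ps, D; rewrite tele_ctx_cons.
Qed.

Lemma econvsI ts ts' : size ts = size ts' ->
  (forall j, j < size ts -> econv (nth (TVar 0) ts j) (nth (TVar 0) ts' j)) -> econvs ts ts'.
Proof.
move=> e h; split=> // j; have [/h //|hj] := ltnP j (size ts).
by rewrite !nth_default // -e.
Qed.

Lemma econv_tren_addn_inj p t t' :
  econv (tren (addn p) t) (tren (addn p) t') -> econv t t'.
Proof.
move/(econv_tren (fun k => k - p)); rewrite !tren_comp !tren_id //; exact: addKn.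
Qed.

Lemma tinst_take_ren ts j q k : j <= size ts ->
  tinst (take j ts) (iter j up_ren (addn q) k) =
  if k < j then nth (TVar 0) ts (j - k.+1) else TVar (q + (k - j)).
Proof.
move=> hj; rewrite tinstE iter_up_renE size_takel //.
case: (ltnP k) => h; first by rewrite h nth_take //; lia.
by rewrite ltnNge leq_addr /= addKn.
Qed.

(* Under the binders of [M], the arguments of [y] are themselves              *)
(* eta-expansions of the bound variables.                                     *)
Lemma eta_var_type G M C y T :
  has_type G M C -> econv (er_o M) (TVar y) -> obj_in G y T -> econv (er_f C) (er_f T).
Proof.
move: {2}(tmsize (er_o M)).+1 (ltnSn (tmsize (er_o M))) => n.
elim: n G M C y T => // n IH G M C y T hn hM.
have [Fs [z [Ps [D [eM eC [Bs [Cs [A0 [hz _ eP hj hD]]]]]]]]] := has_type_lams_inv hM.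
subst M C; rewrite er_lams => /econv_tlams_inv; rewrite er_apps.
set m := size Fs in hn *.
(* Below its $m$ abstractions, $M$ must be $y$, weakened by $m$, applied to terms convertible to the
   $m$ bound variables. *)
move=> /(@econv_tapps_inj (TVar z) (TVar (m + y))) [] // [ez] eqP hT; subst z.
have sP : size Ps = m by case: eqP => + _; rewrite size_map size_tvars.
have := obj_in_cat (tele_ctx Fs) hT; rewrite nobj_tele -/m => hT'.
have := obj_in_fun hT' hz => /fam_ren_pis_inv [Bs0 [A00 [eT eB eA]]]; subst T Bs A0.
move: eP; rewrite size_ren_tele sP => sB.
(* Instantiating the $j$-th domain by the bound variables themselves only weakens it past the $m-j$
   remaining binders. *)
have E j : j <= m -> forall B, econv
    (tsubst (tinst (take j (map er_o Ps))) (tren (iter j up_ren (addn m)) B))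
    (tren (addn (m - j)) B).
  move=> hjm B; rewrite tsubst_tren tren_tsubst.
  apply: (@econv_trans _ (tsubst (fun k => tinst (take j (tvars m)) (iter j up_ren (addn m) k)) B)).
    by apply: econv_tsubstr => k; apply: tinst_econv; apply: econvs_take.
  rewrite (@eq_tsubst _ (fun k => TVar (m - j + k))) // => k.
  rewrite tinst_take_ren ?size_tvars //; case: ltnP => h; last by congr TVar; lia.
  by rewrite nth_tvars; [congr TVar|]; lia.
rewrite !er_pis; apply: tpis_econv.
  apply: econvsI; rewrite !size_map -/m // => j hjm.
  rewrite !(nth_map (FVar 0)) -?sB //.
  have hjB : j < size (ren_tele (addn m) Bs0) by rewrite size_ren_tele -sB.
  have [h1 h2] := hj j hjB.
  apply: (@econv_tren_addn_inj (m - j)).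
  apply: econv_trans (E j (ltnW hjm) _).
  rewrite nth_ren_tele er_f_ren in h2; apply: econv_trans h2.
  (* Argument $j$ is smaller than $M$ and convertible to the $j$-th bound variable, so its type is
     the annotation of that binder. *)
  apply: econv_sym; rewrite -er_f_ren; apply: IH h1 _ (obj_in_tele G hjm).
    have := @tmsize_tapps (TVar (m + y)) (map er_o Ps) j.
    rewrite size_map sP => /(_ hjm); rewrite (nth_map (Var 0)) ?sP //.
    by move: hn; rewrite er_lams tmsize_tlams er_apps /=; lia.
  have := eqP.2 j; rewrite nth_tvars // (nth_map (Var 0)) // sP.
  exact.
move: hD; rewrite -sB er_f_ren => hD; apply: econv_trans hD _.
have := E m (leqnn m) (er_f A00).
by rewrite subnn (tren_id (r := addn 0)) // take_oversize ?size_map ?sP.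
Qed.

(** * Contexts related by a substitution *)

(** [D'] is the substituted [D] up to conversion of erasures. No typing of the substitution is
    involved, as the $N_j$ may be untypable. *)
Inductive crel (s : nat -> tm) : ctx -> ctx -> Prop :=
| crel_nil : crel s [::] [::]
| crel_obj D D' A A' : crel s D D' ->
    econv (er_f A') (tsubst (iter (nobj D) tup s) (er_f A)) ->
    crel s (DObj A :: D) (DObj A' :: D')
| crel_fam D D' u K K' : crel s D D' ->
    econv (er_k K') (tsubst (iter (nobj D) tup s) (er_k K)) ->
    crel s (DFam u K :: D) (DFam u K' :: D').

Lemma crel_nobj s D D' : crel s D D' -> nobj D' = nobj D.
Proof. by elim=> //= ? ? ? ? _ ->. Qed.

Lemma tsubst_tup_succn s t : tsubst (tup s) (tren succn t) = tren succn (tsubst s t).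
Proof. by rewrite tsubst_tren tren_of_tsubst. Qed.

Lemma tsubst_iter_tup d s t :
  tsubst (iter d tup s) (tren (addn d) t) = tren (addn d) (tsubst s t).
Proof.
rewrite tsubst_tren tren_of_tsubst; apply: eq_tsubst => k.
by rewrite iter_tupE ltnNge leq_addr /= addKn.
Qed.

Lemma crel_obj_in s D D' G G' v : crel s D D' -> v < nobj D ->
  exists T T', [/\ obj_in (D ++ G) v T, obj_in (D' ++ G') v T' &
                   econv (er_f T') (tsubst (iter (nobj D) tup s) (er_f T))].
Proof.
move=> h; elim: h v => {D D'} //=.
- move=> D D' A A' _ IH hA [_|v]; rewrite ?add1n ?ltnS.
    exists (fam_ren succn A), (fam_ren succn A'); split; [exact: obj_in_here..|].
    by rewrite !er_f_ren /= tsubst_tup_succn; apply: econv_tren.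
  move=> /IH [T [T' [h1 h2 h3]]]; exists (fam_ren succn T), (fam_ren succn T').
  split; [exact: obj_in_obj..|].
  by rewrite !er_f_ren /= tsubst_tup_succn; apply: econv_tren.
- move=> D D' u K K' _ IH _ v; rewrite add0n => /IH [T [T' [h1 h2 h3]]].
  by exists T, T'; split=> //; apply: obj_in_fam.
Qed.

Lemma crel_fam_in s D D' G G' u K K' : crel s D D' -> u \notin fam_dom G ->
  u \notin fam_dom G' ->
  ctx_wf (D ++ G) -> ctx_wf (D' ++ G') ->
  fam_in (D ++ G) u K -> fam_in (D' ++ G') u K' ->
  econv (er_k K') (tsubst (iter (nobj D) tup s) (er_k K)).
Proof.
move=> h nG nG'; elim: h K K' => {D D'} //=.
- by move=> K K' _ _ /fam_in_dom h; rewrite h in nG.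
- move=> D D' A A' _ IH _ K K' w w' h h'; inversion w; inversion w'; inversion h; inversion h'; subst.
  by rewrite !er_k_ren tsubst_tup_succn; apply: econv_tren; apply: IH.
- move=> D D' v L L' c IH hL K K' w w' h h'; rewrite add0n.
  inversion w as [| |? ? ? wD nv]; inversion w' as [| |? ? ? wD' nv']; subst.
  inversion h as [| |? ? ? ? ? hh]; inversion h' as [| |? ? ? ? ? hh']; subst => //.
  + by rewrite (fam_in_dom hh') in nv'.
  + by rewrite (fam_in_dom hh) in nv.
  + exact: IH.
Qed.

(** * Rigid occurrences *)

Fixpoint tsubst_tele (s : nat -> tm) (ts : seq tm) : seq tm :=
  if ts is t :: ts' then tsubst s t :: tsubst_tele (tup s) ts' else [::].

Lemma size_tsubst_tele s ts : size (tsubst_tele s ts) = size ts.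
Proof. by elim: ts s => //= t ts IH s; rewrite IH. Qed.

Lemma nth_tsubst_tele s ts j : j < size ts ->
  nth (TVar 0) (tsubst_tele s ts) j = tsubst (iter j tup s) (nth (TVar 0) ts j).
Proof. by elim: ts s j => [|t ts IH] s [|j] //= hj; rewrite IH // -iterSr. Qed.

Lemma tsubst_tpis s ts t :
  tsubst s (tpis ts t) = tpis (tsubst_tele s ts) (tsubst (iter (size ts) tup s) t).
Proof. by elim: ts s => //= u ts IH s; rewrite IH -iterSr. Qed.

Lemma finite_choice (T : Type) (x0 : T) (Q : nat -> T -> Prop) k :
  (forall j, j < k -> exists x, Q j x) -> exists f, forall j, j < k -> Q j (f j).
Proof.
elim: k => [|k IH] h; first by exists (fun _ => x0).
have [j hj|f hf] := IH; first by apply: h; apply: ltnW.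
have [x hx] := h k (ltnSn k).
exists (fun j => if j == k then x else f j) => j; rewrite ltnS leq_eqVlt.
by case: eqP => [->|_ /= /hf].
Qed.

(* [psi j] instantiates the j-th domain of [pis Bs A] by [th], weakened to    *)
(* [D ++ G], and the preceding [y]s.                                          *)
Lemma abstract_pattern G D (ys : seq nat) (T : nat -> fam) Bs A (th : nat -> tm) t M C :
  let d := nobj D in
  let k := size ys in
  let F u := is_true (u \in fam_dom G) in
  let psi j v := if v < j then TVar (nth 0 ys (j - v.+1))
                 else tren (addn d) (th (v - j)) in
  uniq ys -> {in ys, forall y, y < d} -> size Bs = k ->
  (forall j, j < k -> obj_in (D ++ G) (nth 0 ys j) (T j)) ->
  (forall j, j < k -> okt (fun _ => True) F (er_f (nth (FVar 0) Bs j))) ->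
  okt (fun _ => True) F t -> (forall v, okt (fun _ => True) F (th v)) ->
  (forall j, j < k -> econv (er_f (T j)) (tsubst (psi j) (er_f (nth (FVar 0) Bs j)))) ->
  has_type (D ++ G) M C -> ~~ is_lam (er_o M) ->
  econv (er_o M) (tapps (tren (addn d) t) (map TVar ys)) ->
  econv (er_f C) (tsubst (psi k) (er_f A)) ->
  exists M' C', [/\ has_type G M' C', econv (er_o M') t &
                    econv (er_f C') (tsubst th (er_f (pis Bs A)))].
Proof.
move=> d k F psi uys ltd sB hT okB okt0 okth cT hM nlam cM cC.
have wDG : ctx_wf (D ++ G) := typing_ctx_wf.2 _ _ _ hM.
have wG : ctx_wf G := ctx_wf_cat wDG.
(* The variables allowed at stage $j$: those of $\Gamma$ and the first $j$ pattern variables. A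
   variable outside [ys] has index [k], hence is not below [j] for [j <= k]. *)
pose P j v := d <= v \/ index v ys < j.
(* Sends the first $j$ pattern variables to the innermost $j$ indices, in pattern order, and shifts
   those of $\Gamma$ accordingly; the value at other local variables is a dummy. *)
pose r j v := if v < d then j - (index v ys).+1 else j + (v - d).
have Pmono j j' v : j <= j' -> P j v -> P j' v.
  by move=> h [h1|h1]; [left|right; apply: leq_trans h1 h].
have Pin j v : j <= k -> P j v -> d <= v \/ exists l, [/\ l < j, v = nth 0 ys l & index v ys = l].
  move=> hj [h|h]; first by left.
  by right; exists (index v ys); rewrite nth_index // -index_mem; apply: leq_trans h hj.
have idx l : l < k -> index (nth 0 ys l) ys = l by move=> h; rewrite index_uniq.
have ylt l : l < k -> nth 0 ys l < d by move=> h; apply: ltd; apply: mem_nth.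
have okd j u : okt (fun _ => True) F u -> okt (P j) F (tren (addn d) u).
  by rewrite okt_tren; apply: okt_sub => v _; left; apply: leq_addr.
have famG u K : F u -> fam_in (D ++ G) u K ->
    exists2 K0, K = kind_ren (addn d) K0 & fam_in G u K0.
  by move=> hu hK; apply: fam_in_cat_inv hK (fam_dom_wf wDG hu).
have closed j : j <= k -> (forall l, l < j -> okf (P l) F (T l)) -> ctx_closed (P j) F (D ++ G).
  move=> hj ok; split.
  - move=> v U /(Pin _ _ hj) [hv|[l [hl -> _]]] hU.
      have [U0 -> h0] := obj_in_cat_inv hU hv.
      rewrite (ok_ren F).2; apply: okf_sub (typing_fam_dom.1 _ _ _ (obj_in_has_kind wG h0)).
      by move=> u _; left; apply: leq_addr.
    rewrite (obj_in_fun hU (hT _ (leq_trans hl hj))).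
    by apply: okf_sub (ok _ hl) => u; apply: Pmono; apply: ltnW.
  - move=> u K hu hK; have [K0 -> h0] := famG _ _ hu hK.
    rewrite okk_ren; apply: okk_sub (fam_in_fam_dom wG h0).
    by move=> v _; left; apply: leq_addr.
have psi_ok j B : j <= k -> okt (fun _ => True) F B -> okt (P j) F (tsubst (psi j) B).
  move=> hj okB0; apply: okt_tsubst okB0 _ => v _; rewrite /psi.
  case: ltnP => h /=; last exact: okd.
  by right; rewrite idx; lia.
(* Strong induction: the canonical type of $y_l$ is convertible to a term over [P l], so its erasure
   lies over [P l]; the types of the earlier $y$s, already treated, make [P l] closed, and the
   annotations follow. *)
have okT : forall l, l < k -> okf (P l) F (T l).
  apply: ltn_ind => l IH hl.
  have hk := obj_in_has_kind wDG (hT _ hl).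
  apply: (typing_ok.1 _ _ _ hk erefl).
    by apply: closed; [apply: ltnW|move=> l' hl'; apply: IH => //; lia].
  apply: okt_econv (typing_normal.1 _ _ _ hk) (cT _ hl) _.
  by apply: psi_ok; [apply: ltnW|apply: okB].
have closed' j : j <= k -> ctx_closed (P j) F (D ++ G).
  by move=> hj; apply: closed => // l hl; apply: okT; lia.
pose e j := fam_ren (r j) (T j).
(* The target context lists the $y$s in pattern order, which may differ from their order in [D]. *)
pose H j := tele_ctx (mkseq e j) ++ G.
have nH j : nobj (tele_ctx (mkseq e j)) = j by rewrite nobj_tele size_mkseq.
have rd j v : r j (d + v) = j + v by rewrite /r ltnNge leq_addr /= addKn.
have ren j : j <= k -> ctx_ren (P j) F (r j) (D ++ G) (H j).
  move=> hj; split.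
  - move=> v U /(Pin _ _ hj) [hv|[l [hl ev il]]] hU.
      have [U0 -> h0] := obj_in_cat_inv hU hv.
      have := obj_in_cat (tele_ctx (mkseq e j)) h0; rewrite nH /r ltnNge hv /=.
      by rewrite fam_ren_comp (@eq_fam_ren _ (addn j) U0) // => u; rewrite -/d -/(r j _) rd.
    have hlk := leq_trans hl hj.
    rewrite ev in hU *; rewrite (obj_in_fun hU (hT _ hlk)) {1}/r ylt // idx //.
    have := @obj_in_tele (mkseq e j) G l; rewrite size_mkseq => /(_ hl).
    rewrite nth_mkseq // /e fam_ren_comp.
    rewrite ((eq_ren_ok F).2 _ _ _ (r j) (okT _ hlk)) // => u /(Pin _ _ (ltnW hlk)).
    rewrite /r; case=> [hu|[l' [hl' -> ->]]]; first by rewrite ltnNge hu /=; lia.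
    by rewrite ylt; lia.
  - move=> u K hu hK; have [K0 -> h0] := famG _ _ hu hK.
    have := fam_in_cat (tele_ctx (mkseq e j)) h0; rewrite nH.
    by rewrite kind_ren_comp (@eq_kind_ren _ (addn j) K0).
have wH j : j <= k -> ctx_wf (H j).
  elim: j => [|j IH] hj; first by [].
  rewrite /H mkseqS tele_ctx_rcons /=; apply: ctx_wf_obj; first by apply: IH; apply: ltnW.
  apply: (typing_ren.1 _ _ _ (obj_in_has_kind wDG (hT _ hj)) erefl (P j) F); first by apply: IH; apply: ltnW.
  - by apply: closed'; apply: ltnW.
  - by apply: ren; apply: ltnW.
  - exact: okT.
have okM : okt (P k) F (er_o M).
  apply: okt_econv (typing_normal.2 _ _ _ hM) cM _.
  rewrite okt_tapps; split; first exact: okd.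
  move=> j; rewrite size_map => hj; rewrite (nth_map 0) //=.
  by right; rewrite idx.
have [oM oC] := typing_ok.2 _ _ _ hM _ _ (closed' _ (leqnn k)) okM
  (fun h => False_ind _ (negP nlam h)).
have hM' := typing_ren.2 _ _ _ hM _ _ _ _ (wH _ (leqnn k)) (closed' _ (leqnn k))
  (ren _ (leqnn k)) oM oC.
(* The renaming turns the $y$s back into bound variables, so [psi j] becomes [th] lifted under $j$
   binders, as in the substituted product type. *)
have psiE j B : j <= k -> tren (r j) (tsubst (psi j) B) = tsubst (iter j tup th) B.
  move=> hj; rewrite tren_of_tsubst; apply: eq_tsubst => v; rewrite /psi iter_tupE.
  case: ltnP => h /=; last by rewrite tren_comp; apply: eq_tren => u; rewrite rd.
  by rewrite /r ylt ?idx; [congr TVar; lia|lia|lia].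
exists (lams (mkseq e k) (obj_ren (r k) M)), (pis (mkseq e k) (fam_ren (r k) C)).
split; first exact: has_type_lams.
- rewrite er_lams size_mkseq er_o_ren.
  (* Eta-expand [t] as many times as there are pattern variables; the body is then the renaming of
     the equation for [M]. *)
  apply: econv_trans (econv_tlams_eta k t); apply: tlams_econv.
  apply: econv_trans (econv_tren (r k) cM) _; rewrite tren_tapps tren_comp.
  rewrite (@eq_tren _ (addn k) t) //; apply: tapps_econv => //.
  apply: econvsI; rewrite !size_map ?size_tvars // => j hj.
  rewrite nth_tvars // (nth_map (TVar 0)) ?size_map // (nth_map 0) //=.
  by rewrite /r ylt // idx.
- rewrite !er_pis tsubst_tpis; apply: tpis_econv.
    apply: econvsI; rewrite size_map size_mkseq ?size_tsubst_tele ?size_map ?sB // => j hj.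
    rewrite nth_tsubst_tele ?size_map ?sB // !(nth_map (FVar 0)) ?size_mkseq ?sB //.
    rewrite nth_mkseq // er_f_ren -psiE; last exact: ltnW.
    by apply: econv_tren; apply: cT.
  by rewrite size_map sB er_f_ren -psiE //; apply: econv_tren.
Qed.

(** Substitution commutes with instantiating a domain by the preceding arguments. With $b, b'$
    corresponding domains of two heads, this passes the invariant on types to the arguments. *)
Lemma econv_inst s b b' c c' Ms Ms' :
  econv b' (tsubst (iter (size Ms) tup s) b) -> econvs Ms' (map (tsubst s) Ms) ->
  econv c (tsubst (tinst Ms) b) -> econv c' (tsubst (tinst Ms') b') ->
  econv c' (tsubst s c).
Proof.
move=> hb hM hc hc'; apply: econv_trans hc' _.
apply: econv_trans (econv_tsubst hb (tinst_econv hM)) _.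
apply: econv_trans (econv_tsubstl s (econv_sym hc)).
rewrite !tsubst_comp; apply: econv_tsubstr => k.
rewrite iter_tupE !tinstE; case: ltnP => h /=.
  by rewrite tinstE size_map h (nth_map (TVar 0)) //; lia.
rewrite tsubst_tren tsubst_id // => v.
by rewrite tinstE size_map ltnNge leq_addr /= addKn.
Qed.

(** A type in the scope of the first $i$ variables, weakened past the others, is instantiated by the
    first $i$ objects alone. *)
Lemma tinst_drop (Ns : seq obj) i m : i <= size Ns ->
  tinst (map er_o Ns) (size Ns - i + m) = tinst (map er_o (take i Ns)) m.
Proof.
move=> hi; rewrite !tinstE !size_map size_takel //.
case: (ltnP m) => h.
  have h1 : size Ns - i + m < size Ns by lia.
  rewrite h1 !(nth_map (Var 0)) ?size_takel //; try lia.
  by rewrite nth_take; [do 2 f_equal; lia|lia].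
have h1 : (size Ns - i + m < size Ns) = false by lia.
by rewrite h1; congr TVar; lia.
Qed.

Lemma tinst_self (Ns : seq obj) m : tinst (map er_o Ns) (size Ns + m) = TVar m.
Proof. by have := @tinst_drop Ns 0 m (leq0n _); rewrite subn0 take0 => ->; rewrite tinstE subn0. Qed.

Lemma tsubst_tinst_self (Ns : seq obj) t :
  tsubst (tinst (map er_o Ns)) (tren (addn (size Ns)) t) = t.
Proof. by rewrite tsubst_tren tsubst_id // => k; rewrite tinst_self. Qed.

Definition xvars (d n : nat) : seq nat := [seq xvar d n j | j <- iota 0 n].

Lemma xvars_succ d n : map succn (xvars d n) = xvars d.+1 n.
Proof. by rewrite /xvars -map_comp; apply: eq_map => j. Qed.

Lemma xvarsP d n y : d <= y < d + n -> y \in xvars d n.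
Proof.
move=> h; apply/mapP; exists (d + n - y.+1); first by rewrite mem_iota; lia.
by rewrite /xvar; lia.
Qed.

(** A head outside $\vec x$ is either local, hence fixed, with related types in the two contexts, or
    comes from $\Gamma$, whose types mention no $x_j$ and are merely weakened differently. *)
Lemma crel_head G (N : seq obj) B D D' y T :
  let s := tinst (map er_o N) in
  let sigma := iter (nobj D) tup s in
  size B = size N -> crel s D D' -> y \notin xvars (nobj D) (size N) ->
  obj_in (D ++ tele_ctx B ++ G) y T ->
  exists y' T', [/\ sigma y = TVar y', obj_in (D' ++ G) y' T' &
                    econv (er_f T') (tsubst sigma (er_f T))].
Proof.
move=> s sigma sB c ny hy; have [hlt|hge] := ltnP y (nobj D).
  have [T1 [T' [h1 h2 h3]]] := crel_obj_in (tele_ctx B ++ G) G c hlt.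
  by exists y, T'; split=> //; [rewrite /sigma iter_tupE hlt|rewrite (obj_in_fun hy h1)].
have [T0 -> h0] := obj_in_cat_inv hy hge.
have hn : size N <= y - nobj D by apply: contraNT ny => h; apply: xvarsP; lia.
have := obj_in_cat_inv h0; rewrite nobj_tele sB => /(_ hn) [T1 -> h1].
exists (nobj D + (y - nobj D - size N)), (fam_ren (addn (nobj D)) T1); split.
- rewrite /sigma iter_tupE ltnNge hge /= /s.
  by have := tinst_self N (y - nobj D - size N); rewrite subnKC // => ->.
- by have := obj_in_cat D' h1; rewrite (crel_nobj c).
- by rewrite /sigma /s !er_f_ren tsubst_iter_tup tsubst_tinst_self.
Qed.

(** Well-formed contexts do not shadow family names, so both lookups end in $\Gamma$ or both in the
    local part. *)
Lemma crel_fam_head G (N : seq obj) B D D' u K K' :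
  let s := tinst (map er_o N) in
  size B = size N -> crel s D D' ->
  ctx_wf (D ++ tele_ctx B ++ G) -> ctx_wf (D' ++ G) ->
  fam_in (D ++ tele_ctx B ++ G) u K -> fam_in (D' ++ G) u K' ->
  econv (er_k K') (tsubst (iter (nobj D) tup s) (er_k K)).
Proof.
move=> s sB c w w' h h'.
have eG : fam_dom (tele_ctx B ++ G) = fam_dom G by rewrite fam_dom_cat fam_dom_tele.
have [hu|hu] := boolP (u \in fam_dom G); last by apply: crel_fam_in c _ _ w w' h h'; rewrite ?eG.
have [|K1 -> h1] := fam_in_cat_inv h; first by apply: fam_dom_wf w _; rewrite eG.
have [|K2 -> h2] := fam_in_cat_inv h1; first by rewrite fam_dom_tele.
have [|K3 -> h3] := fam_in_cat_inv h'; first exact: fam_dom_wf w' hu.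
rewrite (fam_in_fun (ctx_wf_cat w') h3 h2) !er_k_ren nobj_tele sB (crel_nobj c).
by rewrite tsubst_iter_tup tsubst_tinst_self.
Qed.

(** The conclusion of the theorem on erasures; [i] counts from 0, hence [take i N]. *)
Definition solved (G : ctx) (N : seq obj) (B : seq fam) (i : nat) : Prop :=
  exists M C, [/\ has_type G M C, econv (er_o M) (er_o (nth (Var 0) N i)) &
    econv (er_f C) (tsubst (tinst (map er_o (take i N))) (er_f (nth (FVar 0) B i)))].

Lemma rigid_init_solved G (N : seq obj) B i D D' (ys : seq nat) Ms C M' C' :
  let s := tinst (map er_o N) in
  let sigma := iter (nobj D) tup s in
  size B = size N -> i < size N -> crel s D D' ->
  uniq ys -> {in ys, forall y, y < nobj D} -> size Ms = size ys ->
  (forall j, j < size ys -> obj_conv (Var (nth 0 ys j)) (nth (Var 0) Ms j)) ->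
  has_type (D ++ tele_ctx B ++ G) (apps (Var (xvar (nobj D) (size N) i)) Ms) C ->
  has_type (D' ++ G) M' C' ->
  econv (er_o M') (tsubst sigma (er_o (apps (Var (xvar (nobj D) (size N) i)) Ms))) ->
  econv (er_f C') (tsubst sigma (er_f C)) ->
  solved G N B i.
Proof.
move=> s sigma sB hi c uys ltd sM cM hM hM' eM' eC'.
set d := nobj D in sigma ltd hM eM' eC' *; set n := size N in hi hM eM' *.
have w := typing_ctx_wf.2 _ _ _ hM.
have hs := has_type_spine hM.
(* The type of a neutral term is base, so $C'$ is base as well and $M'$ is not an abstraction, as
   [abstract_pattern] requires. *)
have bC' : ebase (er_f C').
  by apply: ebase_econv eC' _; apply: ebase_tsubst; apply: spine_ebase hs.
case: hs => Bs [Cs [A0 [hx _ sMB hj hC]]].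
have hiB : i < size B by rewrite sB.
have hxB := obj_in_tele G hiB; rewrite sB -/n in hxB.
have hx' := obj_in_cat D hxB; rewrite -/d -/(xvar d n i) fam_ren_comp in hx'.
(* The distance from the scope of $B_i$ to the present one: $x_i$ and the later $x$s, then the local
   variables. *)
pose q := d + (n - i).
rewrite (@eq_fam_ren _ (addn q)) in hx'; last by move=> k; rewrite /q; lia.
have [Bs0 [A00 [eB eBs eA0]]] := fam_ren_pis_inv (obj_in_fun hx' hx).
subst Bs A0; rewrite size_ren_tele in hj sMB.
have sBs : size Bs0 = size ys by rewrite -sMB.
have okB : okf (fun _ => True) (fun u => u \in fam_dom G) (pis Bs0 A00).
  have wB := ctx_wf_cat w.
  have := typing_fam_dom.1 _ _ _ (obj_in_has_kind wB hxB).
  by rewrite (ok_ren _).2 fam_dom_cat fam_dom_tele eB.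
have [okB0 _] := (okf_pis _ _ _ _).1 okB.
have eMs : econvs (map er_o Ms) (map TVar ys).
  apply: econvsI; rewrite !size_map // sM => j hjy.
  rewrite (nth_map (Var 0)) ?sM // (nth_map 0) //.
  exact/econv_sym/(obj_conv_econv (cM _ hjy)).
pose th := tinst (map er_o (take i N)).
pose psi j v := if v < j then TVar (nth 0 ys (j - v.+1))
                else tren (addn d) (th (v - j)).
(* Under $\sigma$ the first $j$ binders become the fixed $y$s, and the variables of the scope of
   $B_i$ become the weakened $N$s preceding $N_i$. *)
have E j b : j <= size ys -> econv
    (tsubst sigma (tsubst (tinst (take j (map er_o Ms))) (tren (iter j up_ren (addn q)) b)))
    (tsubst (psi j) b).
  move=> hjy; apply: (@econv_trans _ (tsubst sigma
    (tsubst (tinst (take j (map TVar ys))) (tren (iter j up_ren (addn q)) b)))).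
    apply: econv_tsubstl; apply: econv_tsubstr; apply: tinst_econv; exact: econvs_take.
  rewrite tsubst_comp tsubst_tren (@eq_tsubst _ (psi j)) // => v.
  rewrite tinst_take_ren ?size_map // /psi; case: ltnP => h.
    have hv : j - v.+1 < size ys by lia.
    by rewrite (nth_map 0) //= /sigma iter_tupE ltd // mem_nth.
  rewrite /= /sigma iter_tupE /q -addnA ltnNge leq_addr /= addKn /s.
  by rewrite tinst_drop // ltnW.
have [j hjy|T hT] := @finite_choice fam (FVar 0) (fun j T =>
    obj_in (D' ++ G) (nth 0 ys j) T /\
    econv (er_f T) (tsubst (psi j) (er_f (nth (FVar 0) Bs0 j)))) (size ys).
  have [T1 [T' [h1 h2 h3]]] := crel_obj_in (tele_ctx B ++ G) G c (ltd _ (mem_nth 0 hjy)).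
  exists T'; split=> //; apply: econv_trans h3 _.
  have hjB : j < size Bs0 by rewrite sBs.
  have [g1 g2] := hj _ hjB.
  (* The argument is an eta-expansion of $y_j$, so the declared type of $y_j$ is the instantiated
     domain of $B_i$. *)
  have g3 := eta_var_type g1 (econv_sym (obj_conv_econv (cM _ hjy))) h1.
  apply: econv_trans (econv_tsubstl _ (econv_sym g3)) _.
  apply: econv_trans (econv_tsubstl _ g2) _.
  by rewrite nth_ren_tele er_f_ren; apply: E; apply: ltnW.
have dD' : nobj D' = d := crel_nobj c.
have := @abstract_pattern G D' ys T Bs0 A00 th (er_o (nth (Var 0) N i)) M' C'.
rewrite dD' -/psi => /(_ uys ltd sBs).
case.
- by move=> j /hT [].
- by move=> j hjy; apply: okf_er; apply: okf_sub (okB0 _ _); rewrite ?sBs.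
- exact: okt_er_o.
- by move=> v; rewrite /th -er_inst; apply: okt_er_o.
- by move=> j /hT [].
- exact: hM'.
- have [[A1 [M1 [B1 [_ eC _]]]]|[z [Ps [-> _]]]] := has_type_inv hM'.
    by case: (@ebase_pi (er_f A1) (er_f B1)); rewrite eC in bC'.
  by rewrite er_apps; case eP: (tapps _ _) => //; case: (@tapps_lam (TVar z) _ _ isT eP).
- apply: econv_trans eM' _; rewrite er_apps tsubst_tapps; apply: tapps_econv.
    rewrite /= /sigma iter_tupE /xvar ltnNge leq_addr /= addKn /s tinstE size_map.
    have -> : n - i.+1 < size N by lia.
    rewrite (nth_map (Var 0)); last by lia.
    by have -> : size N - (n - i.+1).+1 = i by lia.
  apply: econvsI; rewrite !size_map // sM => j hjy.
  rewrite (nth_map (TVar 0)) ?size_map ?sM // (nth_map 0) //.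
  have -> : TVar (nth 0 ys j) = tsubst sigma (TVar (nth 0 ys j)).
    by rewrite /= /sigma iter_tupE ltd // mem_nth.
  by apply: econv_tsubstl; have := eMs.2 j; rewrite [X in econv _ X](nth_map 0).
- apply: econv_trans eC' _; apply: econv_trans (econv_tsubstl _ hC) _.
  have := E (size ys) (er_f A00) (leqnn _).
  by rewrite take_oversize ?size_map ?sM // er_f_ren sBs.
by move=> M1 [C1 [h1 h2 h3]]; exists M1, C1; split=> //; rewrite eB.
Qed.

(** Induction on rigidity, generalized over the local contexts, which grow at each abstraction.
    Allowed pattern variables are local, hence fixed by the substitution. *)
Lemma rigid_obj_solved G (N : seq obj) B i xs delta x M :
  let s := tinst (map er_o N) in
  size B = size N -> i < size N -> obj_rigid xs delta x M ->
  forall D D' C M' C',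
  xs = xvars (nobj D) (size N) -> x = xvar (nobj D) (size N) i ->
  {in delta, forall y, y < nobj D} -> crel s D D' ->
  has_type (D ++ tele_ctx B ++ G) M C -> has_type (D' ++ G) M' C' ->
  econv (er_o M') (tsubst (iter (nobj D) tup s) (er_o M)) ->
  econv (er_f C') (tsubst (iter (nobj D) tup s) (er_f C)) ->
  solved G N B i.
Proof.
move=> s sB hi; elim=> {xs delta x M}.
- move=> xs delta x ys Ms uys sub sM cM D D' C M' C' exs ex ld c hM hM' eM eC; subst x.
  by apply: (rigid_init_solved sB hi c uys _ sM cM hM hM' eM eC) => y /sub/ld.
- move=> xs delta x y Ms j ny hj _ IH D D' C M' C' exs ex ld c hM hM' eM eC; subst xs x.
  have hs := has_type_spine hM.
  have bC' : ebase (er_f C').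
    by apply: ebase_econv eC _; apply: ebase_tsubst; apply: spine_ebase hs.
  case: hs => Bs [Cs [A0 [hy _ sMB hC _]]].
  have [y' [T' [ey hy' eT]]] := crel_head sB c ny hy.
  have [[A1 [M1 [B1 [_ eC1 _]]]]|[z [Ps [eM' hs']]]] := has_type_inv hM'.
    by case: (@ebase_pi (er_f A1) (er_f B1)); rewrite eC1 in bC'.
  subst M'; case: hs' => Bs' [Cs' [A0' [hz _ sPB hC' _]]].
  move: eM; rewrite !er_apps tsubst_tapps /= ey.
  move=> /(@econv_tapps_inj (TVar z) (TVar y')) [] // [ez] eP; subst z.
  have sPM : size Ps = size Ms by case: eP => + _; rewrite !size_map.
  have eT' := obj_in_fun hy' hz; subst T'.
  (* The types of the two heads are related by $\sigma$, so their domains correspond one by one. *)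
  move: eT; rewrite !er_pis tsubst_tpis => /econv_tpis_inj [].
    by rewrite size_tsubst_tele !size_map -sPB sPM.
  move=> eB _.
  have hjB : j < size Bs by rewrite -sMB.
  have hjB' : j < size Bs' by rewrite -sPB sPM.
  have [h1 h2] := hC _ hjB; have [h1' h2'] := hC' _ hjB'.
  apply: (IH D D' _ _ _ erefl erefl ld c h1 h1').
    have := eP.2 j; rewrite !(nth_map (TVar 0)) ?size_map //.
    by rewrite !(nth_map (Var 0)) ?sPM.
  apply: econv_inst h2 h2'; last first.
    by rewrite map_take; apply: econvs_take.
  rewrite size_takel ?size_map; last exact: ltnW.
  have := eB.2 j; rewrite nth_tsubst_tele ?size_map //.
  by rewrite !(nth_map (FVar 0)).
- move=> xs delta x A M _ IH D D' C M' C' exs ex ld c hM hM' eM eC; subst xs x.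
  have [[A1 [M1 [C1 [[<- <-] eC1 hM1]]]]|[z [Ps [/= e _]]]] := has_type_inv hM; last first.
    by move: e; elim/last_ind: Ps => // Ps P _; rewrite /apps foldl_rcons.
  subst C.
  (* A type convertible to a product is not base, so $M'$ is an abstraction too and the descent goes
     under both binders. *)
  have [[A' [M1' [C1' [eM1' eC1' hM1']]]]|[z [Ps [_ /spine_ebase b]]]] := has_type_inv hM'; last first.
    by case: (ebase_pi (ebase_econv (econv_sym eC) b)).
  subst M' C'; case: (econv_pi_inj eC) => eA eC1.
  apply: (IH (DObj A :: D) (DObj A' :: D') C1 M1' C1') => //.
  + by rewrite xvars_succ.
  + by move=> y; rewrite inE => /orP [/eqP ->|/mapP [y' /ld h ->]].
  + exact: crel_obj.
  + exact: econv_lam_inj eM.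
Qed.

(** * From the typing hypotheses to the start of the descent *)

Lemma tsubst_iter_inst d N t : tsubst (fun k => er_o (iter d up (inst N) k)) t =
  tsubst (iter d tup (tinst (map er_o N))) t.
Proof.
apply: eq_tsubst => k; rewrite er_iter_up; elim: d k => [|d IH] k; first exact: er_inst.
exact: eq_tup.
Qed.

Lemma ctx_conv_crel N D D' :
  ctx_conv (ctx_subst (inst N) D) D' -> crel (tinst (map er_o N)) D D'.
Proof.
elim: D D' => [|[A|u K] D IH] D' /= h; inversion h as [|? ? ? ? hd hD]; subst.
- exact: crel_nil.
- inversion hd as [? ? hA|]; subst; apply: crel_obj; first exact: IH.
  by apply: econv_sym; rewrite -tsubst_iter_inst -er_f_subst; apply: fam_conv_econv.
- inversion hd as [|? ? ? hK]; subst; apply: crel_fam; first exact: IH.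
  by apply: econv_sym; rewrite -tsubst_iter_inst -er_k_subst; apply: kind_conv_econv.
Qed.

Lemma fapps_inj u u' Ms Ms' :
  fapps (FVar u) Ms = fapps (FVar u') Ms' -> u = u' /\ Ms = Ms'.
Proof.
elim/last_ind: Ms Ms' => [|Ms M IH] Ms'; elim/last_ind: Ms' => [|Ms' M' _];
  rewrite /fapps ?foldl_rcons //=; first by case.
by case=> /IH [-> ->] ->.
Qed.

Definition fspine (G : ctx) (u : fname) (Ps : seq obj) : Prop :=
  exists Bs Cs,
  [/\ fam_in G u (kpis Bs KType), size Ps = size Bs &
      forall j, j < size Bs ->
        has_type G (nth (Var 0) Ps j) (nth (FVar 0) Cs j) /\
        econv (er_f (nth (FVar 0) Cs j))
          (tsubst (tinst (take j (map er_o Ps))) (er_f (nth (FVar 0) Bs j)))].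

Lemma has_kind_inv G A : has_kind G A KType ->
  (exists A1 A2, A = Pi A1 A2) \/ (exists u Ps, A = fapps (FVar u) Ps /\ fspine G u Ps).
Proof.
move=> h; inversion h as [? A1 A2| |? u Bs Cs Ns _ hu eN hnf hN]; subst.
  by left; exists A1, A2.
right; exists u, Ns; split=> //; exists Bs, Cs; split=> // j hj; split; first exact: hN.
have := beta_nf_econv (hnf _ hj); rewrite er_f_subst => /econv_sym e.
by apply: econv_trans e _; apply: econv_tsubstr => k; rewrite er_inst map_take.
Qed.

Lemma fapps_pi u Ms A B : fapps (FVar u) Ms <> Pi A B.
Proof. by elim/last_ind: Ms => // Ms M _; rewrite /fapps foldl_rcons. Qed.

Theorem theorem2 (n : nat) (N : n.-tuple obj) (B : n.-tuple fam)
    (Gamma Delta : ctx) (A : fam) (i : 'I_n)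
    (A_base : is_base A)
    (A_rigid : fam_rigid [seq xvar (nobj Delta) n j | j <- iota 0 n]
                         (xvar (nobj Delta) n i) A)
    (A_type : has_kind (Delta ++ tele_ctx B ++ Gamma) A KType)
    (AN_type : lf_is_type Gamma (ctx_subst (inst N) Delta)
                 (fam_subst (iter (nobj Delta) up (inst N)) A)) :
  lf_has_type Gamma (tnth N i) (fam_subst (inst (take i N)) (tnth B i)).
Proof.
have sN : size N = n := size_tuple N.
have sB : size B = size N by rewrite !size_tuple.
have hi : i < size N by rewrite sN.
(* A solution on erasures suffices, since convertible erasures give convertible annotated terms. *)
suff [M [C [hM eM eC]]] : solved Gamma N B i.
  exists M, C; split=> //.
    by apply: econv_obj_conv; apply: econv_sym; rewrite (tnth_nth (Var 0)).
  apply: econv_fam_conv; apply: econv_sym; rewrite (tnth_nth (FVar 0)) er_f_subst.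
  by apply: econv_trans eC _; apply: econv_tsubstr => k; rewrite er_inst.
case: AN_type => D' [A' [/ctx_conv_crel c /fam_conv_econv eA hA']].
have w := typing_ctx_wf.1 _ _ _ A_type; have w' := typing_ctx_wf.1 _ _ _ hA'.
have [[A1 [A2 e]]|[u [Ms [eAu [Bs [Cs [hu sM hC]]]]]]] := has_kind_inv A_type.
  by case: A_base => u [Ms e']; case: (@fapps_pi u Ms A1 A2); rewrite -e'.
subst A.
have {}eA : econv (er_f A') (tapps (TFam u)
    (map (tsubst (iter (nobj Delta) tup (tinst (map er_o N)))) (map er_o Ms))).
  apply: econv_trans (econv_sym eA) _; rewrite er_f_subst er_fapps tsubst_tapps /=.
  by rewrite (eq_map (tsubst_iter_inst _ _)).
have [[A1 [A2 e]]|[u' [Ps [eAu' [Bs' [Cs' [hu' sP hC']]]]]]] := has_kind_inv hA'.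
  by subst A'; case: (@econv_pi_tapps _ _ (TFam u) _ isT eA).
(* Substitution leaves the family at the head alone, so both types have the same head and
   convertible arguments. *)
subst A'; move: eA; rewrite er_fapps => /(@econv_tapps_inj (TFam u') (TFam u)) [] // [eu] eP.
subst u'.
have sPM : size Ps = size Ms by case: eP => + _; rewrite !size_map.
(* The kinds of [u] in the two contexts are related by $\sigma$, so the domains of its arguments
   correspond and the descent can start at the rigid argument. *)
have := crel_fam_head sB c w w' hu hu'; rewrite !er_kpis tsubst_tpis => /econv_tpis_inj [].
  by rewrite size_tsubst_tele !size_map -sP -sM sPM.
move=> eB _.
inversion A_rigid as [xs x v Ms' j hj hr e1 e2 e3|]; last by case: (@fapps_pi u Ms A B0).
subst xs x; case: (fapps_inj e3) => _ e; subst Ms'.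
have hjB : j < size Bs by rewrite -sM.
have hjB' : j < size Bs' by rewrite -sP sPM.
have [h1 h2] := hC _ hjB; have [h1' h2'] := hC' _ hjB'.
apply: (rigid_obj_solved sB hi hr _ _ _ c h1 h1') => //.
- by rewrite /xvars sN.
- by rewrite sN.
- have := eP.2 j; rewrite !(nth_map (TVar 0)) ?size_map //.
  by rewrite !(nth_map (Var 0)) ?sPM.
apply: econv_inst h2 h2'; last first.
  by rewrite map_take; apply: econvs_take.
rewrite size_takel ?size_map; last exact: ltnW.
have := eB.2 j; rewrite nth_tsubst_tele ?size_map //.
by rewrite !(nth_map (FVar 0)).
Qed.
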